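(* Let $\mathbb{K}$ be a field, $n,d\ge 1$ and $k\ge 0$ integers, and let $S_{n,d,k}=\bigoplus_{i\ge 0}S_{k+id}$ be the Veronese module, regarded as an $R$-module. Let $\mathbf{c}\in\mathbb{Z}^n$. If $|\mathbf{c}|=k+jd$ for an integer $j$, then for all $i$ $$\beta_{i,\mathbf{c}}(S_{n,d,k})=\dim_{\mathbb{K}}\tilde{H}_{i-1}\bigl(\Gamma_{\mathbf{c}}^{\langle j-1\rangle},\mathbb{K}\bigr),$$ where $\Gamma_{\mathbf{c}}^{\langle j-1\rangle}$ is the $(j-1)$-skeleton of the pile simplicial complex $\Gamma_{\mathbf{c}}$. Moreover, $\beta_{i,\mathbf{c}}(S_{n,d,k})=0$ for all $i$ when $|\mathbf{c}|\neq k+jd$ for all integers $j$.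
   Context: $S=\mathbb{K}[x_1,\dots,x_n]=\bigoplus_{i\ge0}S_i$ with the standard grading ($S_i$ is the space of forms of degree $i$, $S_i=0$ for $i<0$). $\mathcal{A}=\{(a_1,\dots,a_n)\in\mathbb{N}^n : \sum_i a_i=d\}$ (with $0\in\mathbb{N}$), $N=\binom{d+n-1}{d}=|\mathcal{A}|$, and $\mathcal{A}=\{\mathbf{a}_1,\dots,\mathbf{a}_N\}$. $R=\mathbb{K}[y_1,\dots,y_N]$ acts on $S$ via the $\mathbb{K}$-algebra map $\phi:y_i\mapsto \mathbf{x}^{\mathbf{a}_i}$, whose image is the Veronese subring $S^{(d)}=\bigoplus_{i\ge0}S_{id}$. $R$ is $\mathbb{Z}^n$-graded by $\deg y_i=\mathbf{a}_i$, and $S_{n,d,k}$ is a $\mathbb{Z}^n$-graded $R$-module through $\phi$, with $\mathbf{x}^{\mathbf{b}}$ in degree $\mathbf{b}$. The multigraded Betti numbers are $\beta_{i,\mathbf{c}}(M)=\dim_{\mathbb{K}}\operatorname{Tor}_i^R(M,\mathbb{K})_{\mathbf{c}}$. For $\mathbf{c}=(c_1,\dots,c_n)\in\mathbb{Z}^n$, $|\mathbf{c}|=c_1+\dots+c_n$; and $\mathbf{a}\le\mathbf{b}$ in $\mathbb{Z}^n$ means $\mathbf{b}-\mathbf{a}\in\mathbb{N}^n$. The pile simplicial complex is $\Gamma_{\mathbf{c}}=\{F\subseteq\mathcal{A} : \sum_{\mathbf{a}\in F}\mathbf{a}\le\mathbf{c}\}$ (the empty set is a face, of dimension $-1$, exactly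 when $\mathbf{c}\ge 0$; otherwise $\Gamma_{\mathbf{c}}$ has no faces). The $m$-skeleton $\Delta^{\langle m\rangle}$ of a simplicial complex $\Delta$ consists of its faces of dimension at most $m$, i.e. of cardinality at most $m+1$. $\tilde H$ is reduced simplicial homology, computed from the augmented chain complex in which the empty face (if present) spans degree $-1$; a complex with no faces has zero reduced homology in all degrees. *)

(* Defs.v *)
From HB Require Import structures.
From mathcomp Require Import all_boot all_order all_algebra.
From mathcomp Require Import freeg mpoly.

Set Implicit Arguments.
Unset Strict Implicit.
Unset Printing Implicit Defensive.

Import GRing.Theory Num.Theory.

Local Open Scope ring_scope.

Section GradedModules.

Variables (K : fieldType) (n N : nat) (w : 'I_N -> 'rV[int]_n).

Local Notation R := {mpoly K[N]}.
Local Notation V := 'rV[int]_n.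

Definition wdeg (m : 'X_{1..N}) : V := \sum_(i < N) w i *+ m i.

(* R_e for the Z^n-grading deg y_i = w i *)
Definition whomog (e : V) : {pred R} :=
  [pred p : R | all (fun m => wdeg m == e) (msupp p)].

Record grmod := GrMod {
  gm_mod :> lmodType R;
  gm_comp : V -> {pred gm_mod};
  gm_compB : forall c, zmod_closed (gm_comp c);
  gm_compZ : forall e c (p : R) (x : gm_mod),
    p \in whomog e -> x \in gm_comp c -> p *: x \in gm_comp (e + c);
  gm_span : forall x : gm_mod, exists (s : seq V) (f : V -> gm_mod),
    (forall c, f c \in gm_comp c) /\ x = \sum_(c <- s) f c;
  gm_direct : forall (s : seq V) (f : V -> gm_mod),
    uniq s -> (forall c, f c \in gm_comp c) -> \sum_(c <- s) f c = 0 ->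
    forall c, c \in s -> f c = 0
}.

Arguments gm_comp : clear implicits.
Arguments gm_compB : clear implicits.

Lemma whomogP (e : V) (p : R) :
  reflect (forall m, p@_m != 0 -> wdeg m = e) (p \in whomog e).
Proof.
apply: (iffP allP) => h m hm.
  by apply/eqP/h; rewrite mcoeff_msupp.
by apply/eqP/h; rewrite -mcoeff_msupp.
Qed.

Lemma wdegD m1 m2 : wdeg (m1 + m2)%MM = wdeg m1 + wdeg m2.
Proof.
by rewrite /wdeg -big_split; apply: eq_bigr => i _; rewrite mnmDE mulrnDr.
Qed.

Lemma whomogB (e : V) : zmod_closed (whomog e).
Proof.
split; first by apply/whomogP => m; rewrite mcoeff0 eqxx.
move=> p q /whomogP hp /whomogP hq; apply/whomogP => m; rewrite mcoeffB.
case: (eqVneq p@_m 0) => [->|/hp //].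
by rewrite sub0r oppr_eq0 => /hq.
Qed.

Lemma whomogM e1 e2 p q :
  p \in whomog e1 -> q \in whomog e2 -> p * q \in whomog (e1 + e2).
Proof.
move=> /allP hp /allP hq; apply/allP => m /msuppM_le /allpairsP[[m1 m2] /=].
by case=> h1 h2 ->; rewrite wdegD (eqP (hp _ h1)) (eqP (hq _ h2)).
Qed.

Definition wpart (e : V) (p : R) : R :=
  \sum_(m <- msupp p | wdeg m == e) p@_m *: 'X_[m].

Lemma mcoeff_wpart e p m : (wpart e p)@_m = if wdeg m == e then p@_m else 0.
Proof.
rewrite /wpart raddf_sum /=.
under eq_bigr do rewrite mcoeffZ mcoeffX.
have [mp|mp] := boolP (m \in msupp p); last first.
  rewrite (memN_msupp_eq0 mp) if_same big_seq_cond big1 // => m' /andP[m'p _].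
  by case: eqP => [E|_]; rewrite ?mulr0 //; rewrite E (negPf mp) in m'p.
case: ifP => hm.
  rewrite big_mkcond (bigD1_seq m) ?msupp_uniq //= hm eqxx mulr1 big1 ?addr0 //.
  by move=> m' /negPf ->; rewrite mulr0 if_same.
rewrite big1 // => m' hm'; case: eqP => [E|_]; rewrite ?mulr0 //.
by rewrite E hm in hm'.
Qed.

Lemma wpart_homog e p : wpart e p \in whomog e.
Proof.
by apply/whomogP => m; rewrite mcoeff_wpart; case: (wdeg m =P e) => [//|_]; rewrite eqxx.
Qed.

Record gfree := GFree { gbasis : choiceType; gdeg : gbasis -> V }.

Definition free_comp (F : gfree) (c : V) : {pred {freeg (gbasis F) / R}} :=
  [pred x | all (fun b => coeff b x \in whomog (c - gdeg b)) (dom x)].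

Lemma free_compP F c (x : {freeg (gbasis F) / R}) :
  reflect (forall b, coeff b x \in whomog (c - gdeg b)) (x \in free_comp c).
Proof.
apply: (iffP allP) => h b; last by move=> _; apply: h.
have [/h//|/coeff_outdom->] := boolP (b \in dom x).
by case: (whomogB (c - gdeg b)).
Qed.

Lemma free_compB F c : zmod_closed (@free_comp F c).
Proof.
split.
  by apply/free_compP => b; rewrite coeff0; case: (whomogB (c - gdeg b)).
move=> x y /free_compP hx /free_compP hy; apply/free_compP => b.
by rewrite coeffB; case: (whomogB (c - gdeg b)) => _; apply.
Qed.

Lemma free_compZ (F : gfree) e c (p : R) (x : {freeg (gbasis F) / R}) :
  p \in whomog e -> x \in free_comp c -> p *: x \in free_comp (e + c).
Proof.
move=> hp /free_compP hx; apply/free_compP => b.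
by rewrite coeffZ -addrA; apply: whomogM.
Qed.

Definition free_part F (c : V) (x : {freeg (gbasis F) / R}) :
    {freeg (gbasis F) / R} :=
  \sum_(b <- dom x) << wpart (c - gdeg b) (coeff b x) *g b >>.

Lemma coeff_free_part F c x b :
  coeff b (@free_part F c x) = wpart (c - gdeg b) (coeff b x).
Proof.
rewrite /free_part raddf_sum /=.
under eq_bigr do rewrite coeffU.
have [bx|bx] := boolP (b \in dom x).
  rewrite (bigD1_seq b) ?uniq_dom //= eqxx mulr1 big1 ?addr0 //.
  by move=> b' /negPf ->; rewrite mulr0.
rewrite (coeff_outdom bx) big_seq big1 => [|b' b'x].
  by apply/mpolyP => m; rewrite mcoeff_wpart mcoeff0 if_same.
by case: eqP => [E|_]; rewrite ?mulr0 //; rewrite E (negPf bx) in b'x.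
Qed.

Lemma free_span F (x : {freeg (gbasis F) / R}) :
  exists (s : seq V) (f : V -> {freeg (gbasis F) / R}),
    (forall c, f c \in free_comp c) /\ x = \sum_(c <- s) f c.
Proof.
pose s := undup [seq wdeg m + gdeg b | b <- dom x, m <- msupp (coeff b x)].
exists s, (fun c => free_part c x); split.
  by move=> c; apply/free_compP => b; rewrite coeff_free_part wpart_homog.
apply/eqP/freeg_eqP => b; rewrite raddf_sum /=; apply/mpolyP => m.
rewrite raddf_sum /=.
under eq_bigr do rewrite coeff_free_part mcoeff_wpart.
rewrite -big_mkcond /=.
under eq_bigl do rewrite eq_sym subr_eq.
have [h|h] := boolP (m \in msupp (coeff b x)); last first.
  by rewrite (memN_msupp_eq0 h) big1.
have bx : b \in dom x.
  rewrite mem_dom; apply: contraTneq h => ->.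
  by rewrite mcoeff_msupp mcoeff0 eqxx.
rewrite big_mkcond (bigD1_seq (wdeg m + gdeg b)) ?undup_uniq //=; last first.
  by rewrite mem_undup; apply/allpairsPdep; exists b, m.
by rewrite eqxx big1 ?addr0 // => c /negPf ->.
Qed.

Lemma free_direct F (s : seq V) (f : V -> {freeg (gbasis F) / R}) :
  uniq s -> (forall c, f c \in free_comp c) -> \sum_(c <- s) f c = 0 ->
  forall c, c \in s -> f c = 0.
Proof.
move=> us hf h0 c cs; apply/eqP/freeg_eqP => b; rewrite coeff0.
apply/mpolyP => m; rewrite mcoeff0.
have /free_compP/(_ b)/whomogP/(_ m) hc := hf c.
apply/eqP; case: eqVneq => // /[dup] nz /hc hm.
have := congr1 (fun x => (coeff b x)@_m) h0.
rewrite coeff0 mcoeff0 !raddf_sum /= (bigD1_seq c) //= big1 => [|e ec].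
  by move/eqP; rewrite addr0 (negPf nz).
apply/eqP; case: eqVneq => // hne.
have /free_compP/(_ b)/whomogP/(_ m hne) := hf e.
by rewrite hm => /addIr E; rewrite E eqxx in ec.
Qed.

Definition free_grmod (F : gfree) : grmod :=
  @GrMod {freeg (gbasis F) / R} (@free_comp F) (@free_compB F)
    (@free_compZ F) (@free_span F) (@free_direct F).

Coercion free_grmod : gfree >-> grmod.

Definition gr_morph (M M' : grmod) (f : M -> M') : Prop :=
  forall c x, x \in gm_comp M c -> f x \in gm_comp M' c.

(* ... -> F_1 -> F_0 -> M -> 0, with F_i of arbitrary rank *)
Record resolution (M : grmod) := Resolution {
  res_free : nat -> gfree;
  res_d : forall i, {linear res_free i.+1 -> res_free i};
  res_aug : {linear res_free 0 -> M};
  res_d_graded : forall i, gr_morph (res_d i);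
  res_aug_graded : gr_morph res_aug;
  res_aug_surj : forall x : M, exists y, x = res_aug y;
  res_exact0 : forall x, res_aug x = 0 <-> exists y, x = res_d 0 y;
  res_exact : forall i x, res_d i x = 0 <-> exists y, x = res_d i.+1 y
}.

(* The complex F (x)_R K.  K = R / (y_1, .., y_N) is an R-module through
    p |-> p@_0, so tensoring R^(B) with K gives K^(B), and the matrix of the
    induced differential consists of the constant coefficients. *)

Definition tensK (B : choiceType) (x : {freeg B / R}) : {freeg B / K} :=
  \sum_(b <- dom x) << (coeff b x)@_0%MM *g b >>.

Section Tor.

Variables (M : grmod) (P : resolution M).

Local Notation F := (res_free P).

Definition torK_mod (i : nat) := {freeg (gbasis (F i)) / K}.

Definition torK_comp (i : nat) (c : V) : {pred torK_mod i} :=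
  [pred x | all (fun b => gdeg b == c) (dom x)].

Definition torK_d (i : nat) (x : torK_mod i.+1) : torK_mod i :=
  fglift (fun b => tensK (res_d P i << b >>) : torK_mod i) x.

Definition tor_cycle (i : nat) (c : V) : torK_mod i -> Prop :=
  match i return torK_mod i -> Prop with
  | 0 => fun x => x \in torK_comp c
  | _.+1 => fun x => x \in torK_comp c /\ torK_d x = 0
  end.

Definition tor_boundary (i : nat) (c : V) (x : torK_mod i) : Prop :=
  exists2 y : torK_mod i.+1, y \in torK_comp c & x = torK_d y.

End Tor.

(* dim_K (Z / B) = m, for subspaces B <= Z of E: there are m vectors of Z whose
   classes form a basis of Z / B. *)
Definition quotient_dim (E : lmodType K) (Z B : E -> Prop) (m : nat) : Prop :=
  exists v : 'I_m -> E, (forall i, Z (v i)) /\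
    forall z, Z z ->
      exists! a : {ffun 'I_m -> K}, B (z - \sum_(i < m) a i *: v i).

(* beta_{i,c}(M) = dim_K Tor_i^R(M, K)_c = b, with Tor computed by any graded
   free resolution of M; one exists by resolution_exists. *)
Definition betti_eq (M : grmod) (i : nat) (c : V) (b : nat) : Prop :=
  forall P : resolution M,
    quotient_dim (@tor_cycle M P i c) (@tor_boundary M P i c) b.

Section Cover.

Variables (M : grmod) (Q : {pred M}).

Definition cover_pred : {pred V * M} :=
  [pred u | (u.2 \in gm_comp M u.1) && (u.2 \in Q)].

Definition cover : gfree :=
  @GFree {u : V * M | u \in cover_pred} (fun b => (val b).1).

Definition cover_fun : cover -> M := fglift (fun b => (val b).2).

Lemma cover_fun_linear : linear cover_fun.
Proof.
have add x y : cover_fun (x - y) = cover_fun x - cover_fun y.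
  exact: lift_is_additive.
have addf x y : cover_fun (x + y) = cover_fun x + cover_fun y.
  have h0 : cover_fun 0 = 0 by rewrite -[X in cover_fun X](subrr 0) add subrr.
  by rewrite -[y in LHS]opprK add -[- y]add0r add h0 sub0r opprK.
move=> p x y; rewrite addf; congr (_ + _).
rewrite -[x in LHS]freeg_sumE scaler_sumr.
have sumf (s : seq (gbasis cover)) (g : gbasis cover -> cover) :
    cover_fun (\sum_(z <- s) g z) = \sum_(z <- s) cover_fun (g z).
  elim: s => [|z s IH]; last by rewrite !big_cons addf IH.
  by rewrite !big_nil -[X in cover_fun X](subrr 0) add subrr.
rewrite sumf -[x in RHS]freeg_sumE sumf scaler_sumr; apply: eq_bigr => b _.
have -> : p *: << coeff b x *g b >> = << p * coeff b x *g b >>.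
  by apply/eqP/freeg_eqP => b'; rewrite coeffZ !coeffU mulrA.
by rewrite /cover_fun !liftU scalerA.
Qed.

HB.instance Definition _ :=
  GRing.isLinear.Build R cover M _ cover_fun cover_fun_linear.

Definition cover_map : {linear cover -> M} := cover_fun.

Lemma cover_mapE (x : cover) :
  cover_map x = \sum_(b <- dom x) coeff b x *: (val b).2.
Proof.
rewrite -[x in LHS]freeg_sumE raddf_sum; apply: eq_bigr => b _.
exact: liftU.
Qed.

Lemma cover_graded : gr_morph cover_map.
Proof.
move=> c x /free_compP hx; rewrite cover_mapE.
have [h0 hB] := gm_compB M c.
have hD u v : u \in gm_comp M c -> v \in gm_comp M c -> u + v \in gm_comp M c.
  move=> hu hv; rewrite -[v]opprK; apply: (hB) => //.
  by rewrite -sub0r; apply: (hB).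
elim/big_ind: _ => // b _.
by rewrite -(subrK (gdeg b) c); apply: gm_compZ => //; case/andP: (valP b).
Qed.

Hypothesis Qsub : submod_closed Q.
Hypothesis Qgr : forall x, x \in Q -> exists (s : seq V) (f : V -> M),
  (forall c, f c \in gm_comp M c /\ f c \in Q) /\ x = \sum_(c <- s) f c.

Lemma cover_in x : cover_map x \in Q.
Proof.
case: Qsub => h0 hl; rewrite cover_mapE.
elim/big_ind: _ => // [u v hu hv|b _].
  by rewrite -[u]scale1r; apply: (hl).
by rewrite -[_ *: _]addr0; apply: (hl) => //; case/andP: (valP b).
Qed.

Lemma cover_onto x : x \in Q -> exists y, x = cover_map y.
Proof.
move=> /Qgr[s [f [hf ->]]]; elim: s => [|c s [y IH]].
  by exists 0; rewrite big_nil raddf0.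
have hc : (c, f c) \in cover_pred by rewrite inE /=; case: (hf c) => -> ->.
exists (<< (Sub (c, f c) hc : gbasis cover) >> + y).
rewrite big_cons IH [RHS]raddfD; congr (_ + _).
by rewrite [RHS]liftU scale1r.
Qed.

Lemma cover_im x : x \in Q <-> exists y, x = cover_map y.
Proof. by split=> [/cover_onto//|[y ->]]; apply: cover_in. Qed.

End Cover.

Lemma ker_submod (M M' : grmod) (f : {linear M -> M'}) :
  submod_closed [pred x | f x == 0].
Proof.
split=> [|p x y]; rewrite !inE ?raddf0 // linearP.
by move=> /eqP-> /eqP->; rewrite scaler0 addr0.
Qed.

Lemma ker_graded (M M' : grmod) (f : {linear M -> M'}) : gr_morph f ->
  forall x, x \in [pred x | f x == 0] -> exists (s : seq V) (g : V -> M),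
  (forall c, g c \in gm_comp M c /\ g c \in [pred x | f x == 0])
  /\ x = \sum_(c <- s) g c.
Proof.
move=> gf x; rewrite inE => /eqP fx0.
have [s [g [hg xE]]] := gm_span x.
pose h c := \sum_(e <- s | e == c) g e.
have hh c : h c \in gm_comp M c.
  have [h0 hB] := gm_compB M c.
  rewrite /h; elim/big_ind: _ => // [u v hu hv|e /eqP-> //].
  rewrite -[v]opprK; apply: (hB) => //.
  by rewrite -sub0r; apply: (hB).
have xE' : x = \sum_(c <- undup s) h c.
  rewrite xE /h (exchange_big_dep xpredT) //=.
  rewrite [LHS]big_seq [RHS]big_seq; apply: eq_bigr => c cs.
  rewrite big_mkcond (bigD1_seq c) ?undup_uniq ?mem_undup //= eqxx.
  by rewrite big1 ?addr0 // => e; rewrite eq_sym => /negPf ->.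
have fh c : f (h c) = 0.
  have [cs|cs] := boolP (c \in undup s); last first.
    rewrite /h big_seq_cond big1 ?raddf0 // => e /andP[es /eqP E].
    by rewrite mem_undup -E es in cs.
  apply: (@gm_direct M' (undup s) (fun c => f (h c))) => //.
  - exact: undup_uniq.
  - by move=> e; apply: gf.
  by rewrite -raddf_sum -xE'.
exists (undup s), h; split=> // c; split=> //.
by rewrite inE fh.
Qed.

Section StdResolution.

Variable M : grmod.

Record stage := Stage { st_free : gfree; st_pred : {pred st_free} }.

Definition stage0 : stage :=
  @Stage (cover (xpredT : {pred M})) [pred x | cover_map xpredT x == 0].

Definition next_stage (s : stage) : stage :=
  @Stage (cover (@st_pred s)) [pred x | cover_map (@st_pred s) x == 0].

Fixpoint stages (i : nat) : stage :=
  if i is i'.+1 then next_stage (stages i') else stage0.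

Lemma stage_submod i : submod_closed (@st_pred (stages i)).
Proof. by case: i => [|i]; apply: ker_submod. Qed.

Lemma stage_graded i x : x \in @st_pred (stages i) ->
  exists (s : seq V) (g : V -> st_free (stages i)),
  (forall c, g c \in gm_comp _ c /\ g c \in @st_pred (stages i))
  /\ x = \sum_(c <- s) g c.
Proof. by case: i x => [|i] x; apply: ker_graded; apply: cover_graded. Qed.

Lemma resolution_exists : inhabited (resolution M).
Proof.
split; apply: (@Resolution M (fun i => st_free (stages i))
  (fun i => cover_map (@st_pred (stages i))) (cover_map (xpredT : {pred M}))).
- by move=> i; apply: cover_graded.
- exact: cover_graded.
- move=> x; apply: cover_onto => // y _.
  by have [s [f [hf ->]]] := gm_span y; exists s, f.
- move=> x; rewrite -(cover_im (stage_submod 0) (@stage_graded 0)) inE.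
  by split=> /eqP.
move=> i x; rewrite -(cover_im (stage_submod i.+1) (@stage_graded i.+1)) inE.
by split=> /eqP.
Qed.

End StdResolution.

End GradedModules.

Definition num_exps (n d : nat) : nat := 'C(d + n - 1, d).

(* A bijection i |-> a_i from 'I_N onto {m : mdeg m = d}. *)
Record enumeration (n d : nat) := Enumeration {
  en_exp :> 'I_(num_exps n d) -> 'X_{1..n};
  en_inj : injective en_exp;
  en_im : forall m, mdeg m = d <-> exists i, en_exp i = m
}.

Lemma enumeration_exists n d : (0 < n)%N -> inhabited (enumeration n d).
Proof.
case: n => // n _.
pose A := [set t : n.+1.-tuple 'I_d.+1 | (\sum_(i <- t) i)%N == d].
have cA : #|A| = num_exps n.+1 d.
  rewrite card_ord_partitions /num_exps addnS subn1.
  by rewrite -bin_sub ?leq_addr // addKn addnC.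
pose f (t : n.+1.-tuple 'I_d.+1) : 'X_{1..n.+1} :=
  [multinom (tnth t i : nat) | i < n.+1].
have fdeg t : mdeg (f t) = (\sum_(i <- t) i)%N.
  by rewrite mdegE big_tuple; apply: eq_bigr => i _; rewrite mnmE.
have finj : injective f.
  move=> t u /mnmP h; apply: eq_from_tnth => i; apply: val_inj.
  by have := h i; rewrite !mnmE.
split; apply: (@Enumeration n.+1 d
  (fun i => f (enum_val (cast_ord (esym cA) i)))).
  by move=> i j /finj/enum_val_inj/cast_ord_inj.
move=> m; split=> [hm|[i <-]]; last first.
  by rewrite fdeg; apply/eqP; have := enum_valP (cast_ord (esym cA) i); rewrite inE.
pose t : n.+1.-tuple 'I_d.+1 := [tuple inord (m i) | i < n.+1].
have ft : f t = m.
  apply/mnmP => i; rewrite mnmE tnth_mktuple inordK // ltnS -hm mdegE.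
  by rewrite (bigD1 i) //= leq_addr.
have tA : t \in A by rewrite inE -fdeg ft hm.
exists (cast_ord cA (enum_rank_in tA t)).
by rewrite cast_ord_comp cast_ord_id enum_rankK_in.
Qed.

Definition mdegZ n (m : 'X_{1..n}) : 'rV[int]_n := \row_i (m i)%:Z.

Definition en_deg n d (a : enumeration n d) (i : 'I_(num_exps n d)) :
  'rV[int]_n := mdegZ (a i).

Section Veronese.

Variables (K : fieldType) (n d : nat) (a : enumeration n d) (k : nat).

Local Notation N := (num_exps n d).
Local Notation R := {mpoly K[N]}.
Local Notation S := {mpoly K[n]}.

Definition phi (p : R) : S := p \mPo [tuple 'X_[a i] | i < N].

(* the direct sum of the S_(k + i d), i >= 0 *)
Definition vero_pred : {pred S} :=
  [pred f : S | all (fun m => (k <= mdeg m)%N && (d %| mdeg m - k)%N) (msupp f)].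

Lemma vero_predP (f : S) : reflect
  (forall m, f@_m != 0 -> exists i, mdeg m = (k + i * d)%N) (f \in vero_pred).
Proof.
apply: (iffP allP) => h m.
  rewrite -mcoeff_msupp => /h /andP[km /dvdnP[i E]].
  by exists i; rewrite -E subnKC.
rewrite mcoeff_msupp => /h[i ->].
by rewrite leq_addr addKn dvdn_mull.
Qed.

Lemma vero_zmod : zmod_closed vero_pred.
Proof.
split; first by apply/vero_predP => m; rewrite mcoeff0 eqxx.
move=> f g /vero_predP hf /vero_predP hg; apply/vero_predP => m.
rewrite mcoeffB; case: (eqVneq f@_m 0) => [->|/hf //].
by rewrite sub0r oppr_eq0 => /hg.
Qed.

HB.instance Definition _ :=
  GRing.isZmodClosed.Build S vero_pred vero_zmod.

(* The argument only records which enumeration, hence which map phi, gives the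
   R-module structure. *)
Definition vero (_ : enumeration n d) : Type := {f : S | f \in vero_pred}.

HB.instance Definition _ := SubType.on (vero a).
HB.instance Definition _ := Choice.on (vero a).
HB.instance Definition _ := [SubChoice_isSubZmodule of vero a by <:].

Lemma en_mdeg i : mdeg (a i) = d.
Proof. by apply/en_im; exists i. Qed.

Lemma phiD : {morph phi : p q / p + q}.
Proof. exact: raddfD. Qed.

Lemma phiM : {morph phi : p q / p * q}.
Proof. exact: rmorphM. Qed.

Lemma phi1 : phi 1 = 1.
Proof. exact: rmorph1. Qed.

Lemma phiX m : phi 'X_[m] = 'X_[\big[mnm_add/0%MM]_(i < N) (a i *+ m i)%MM].
Proof.
rewrite /phi comp_mpolyX.
under eq_bigr do rewrite tnth_mktuple mpolyXn.
by rewrite mprodXE.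
Qed.

Lemma msupp_phi p m : m \in msupp (phi p) ->
  exists2 e, e \in msupp p & m = \big[mnm_add/0%MM]_(i < N) (a i *+ e i)%MM.
Proof.
rewrite /phi comp_mpolyEX => /msupp_sum_le /flatten_mapP[e].
rewrite filter_predT => he /msuppZ_le; rewrite -/(phi 'X_[e]) phiX msuppX.
by rewrite inE => /eqP ->; exists e.
Qed.

Lemma vero_phiM p (f : S) : f \in vero_pred -> phi p * f \in vero_pred.
Proof.
move=> /allP hf; apply/allP => m /msuppM_le /allpairsP[[m1 m2] /= []].
move=> /msupp_phi[e _ ->] /hf /andP[k2 d2] ->.
have d1 : (d %| mdeg (\big[mnm_add/0%MM]_(i < N) (a i *+ e i)%MM))%N.
  rewrite mdeg_sum; elim/big_ind: _ => // [u v|i _]; first exact: dvdn_add.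
  by rewrite mdegMn en_mdeg dvdn_mulr.
rewrite mdegD -(addnBA _ k2) dvdn_add // andbT.
exact: leq_trans k2 (leq_addl _ _).
Qed.

Definition vero_scale (p : R) (f : vero a) : vero a :=
  Sub (phi p * val f) (vero_phiM p (valP f)).

Fact vero_scaleA p q f : vero_scale p (vero_scale q f) = vero_scale (p * q) f.
Proof. by apply: val_inj; rewrite /= phiM mulrA. Qed.

Fact vero_scale1 : left_id 1 vero_scale.
Proof. by move=> f; apply: val_inj; rewrite /= phi1 mul1r. Qed.

Fact vero_scaleDr : right_distributive vero_scale +%R.
Proof. by move=> p f g; apply: val_inj; rewrite /= mulrDr. Qed.

Fact vero_scaleDl f : {morph vero_scale^~ f : p q / p + q}.
Proof. by move=> p q; apply: val_inj; rewrite /= phiD mulrDl. Qed.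

HB.instance Definition _ := GRing.Zmodule_isLmodule.Build R (vero a)
  vero_scaleA vero_scale1 vero_scaleDr vero_scaleDl.

(* x^b lies in degree b *)
Definition vero_comp (c : 'rV[int]_n) : {pred vero a} :=
  [pred f : vero a | all (fun m => mdegZ m == c) (msupp (val f))].

Lemma vero_compP c (f : vero a) :
  reflect (forall m, (val f)@_m != 0 -> mdegZ m = c) (f \in vero_comp c).
Proof.
apply: (iffP allP) => h m hm.
  by apply/eqP/h; rewrite mcoeff_msupp.
by apply/eqP/h; rewrite -mcoeff_msupp.
Qed.

Lemma vero_compB c : zmod_closed (vero_comp c).
Proof.
split; first by apply/vero_compP => m; rewrite mcoeff0 eqxx.
move=> f g /vero_compP hf /vero_compP hg; apply/vero_compP => m.
rewrite mcoeffB; case: (eqVneq (val f)@_m 0) => [->|/hf //].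
by rewrite sub0r oppr_eq0 => /hg.
Qed.

Lemma mdegZD (m1 m2 : 'X_{1..n}) : mdegZ (m1 + m2)%MM = mdegZ m1 + mdegZ m2.
Proof. by apply/rowP => i; rewrite !mxE mnmDE PoszD. Qed.

Lemma mdegZ_inj : injective (@mdegZ n).
Proof.
by move=> m1 m2 /rowP h; apply/mnmP => i; have := h i; rewrite !mxE => -[].
Qed.

Lemma mdegZ_wdeg (e : 'X_{1..N}) :
  mdegZ (\big[mnm_add/0%MM]_(i < N) (a i *+ e i)%MM) = wdeg (en_deg a) e.
Proof.
apply/rowP => j; rewrite mxE mnm_sumE /wdeg summxE.
rewrite (big_morph Posz PoszD (erefl _)); apply: eq_bigr => i _.
by rewrite mulmxnE mulmnE !mxE PoszM -[RHS]mulr_natr natz.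
Qed.

Lemma vero_compZ e c (p : R) (f : vero a) :
  p \in whomog (en_deg a) e -> f \in vero_comp c -> p *: f \in vero_comp (e + c).
Proof.
move=> /allP hp /allP hf; apply/allP => m /msuppM_le /allpairsP[[m1 m2] /= []].
move=> /msupp_phi[u hu ->] /hf /eqP hm2 ->.
by rewrite mdegZD mdegZ_wdeg (eqP (hp _ hu)) hm2.
Qed.

Fact vero_monomial (f : vero a) m :
  m \in msupp (val f) -> (val f)@_m *: 'X_[m] \in vero_pred.
Proof.
move=> mf; apply/allP => m' /msuppZ_le; rewrite msuppX inE => /eqP ->.
by case: f mf => /= f /allP; apply.
Qed.

Lemma vero_span (f : vero a) :
  exists (s : seq 'rV[int]_n) (g : 'rV[int]_n -> vero a),
    (forall c, g c \in vero_comp c) /\ f = \sum_(c <- s) g c.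
Proof.
pose g c : S := \sum_(m <- msupp (val f) | mdegZ m == c) (val f)@_m *: 'X_[m].
have g_in c : g c \in vero_pred.
  rewrite /g big_seq_cond; apply: rpred_sum => m /andP[mf _].
  exact: vero_monomial.
exists (map (@mdegZ n) (msupp (val f))), (fun c => Sub (g c) (g_in c)).
split=> [c|].
  apply/allP => m /= /msupp_sum_le /flatten_mapP[m'].
  rewrite mem_filter => /andP[hm' _] /msuppZ_le.
  by rewrite msuppX inE => /eqP ->.
apply: val_inj; rewrite raddf_sum /= big_map [LHS]mpolyE.
rewrite [LHS]big_seq [RHS]big_seq; apply: eq_bigr => m mf.
rewrite /g big_mkcond (bigD1_seq m) ?msupp_uniq //= eqxx big1 ?addr0 // => m' mm'.
by case: eqP => // /mdegZ_inj E; rewrite E eqxx in mm'.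
Qed.

Lemma vero_direct (s : seq 'rV[int]_n) (g : 'rV[int]_n -> vero a) :
  uniq s -> (forall c, g c \in vero_comp c) -> \sum_(c <- s) g c = 0 ->
  forall c, c \in s -> g c = 0.
Proof.
move=> us hg h0 c cs; apply: val_inj; apply/mpolyP => m; rewrite mcoeff0.
have /vero_compP/(_ m) hc := hg c.
apply/eqP; case: eqVneq => // /[dup] nz /hc hm.
have := congr1 (fun x : vero a => (val x)@_m) h0.
rewrite mcoeff0 !raddf_sum /= (bigD1_seq c) //= big1 => [|e ec].
  by move/eqP; rewrite addr0 (negPf nz).
apply/eqP; case: eqVneq => // hne.
have /vero_compP/(_ m hne) := hg e.
by rewrite hm => E; rewrite E eqxx in ec.
Qed.

Definition veronese : grmod K (en_deg a) :=
  @GrMod K n N (en_deg a) (vero a) vero_comp vero_compB vero_compZ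
    vero_span vero_direct.

End Veronese.

Section Simplicial.

Variables (K : fieldType) (N : nat).

Definition face_dim (F : {set 'I_N}) : int := #|F|%:Z - 1.

Definition skeleton (m : int) (D : {set {set 'I_N}}) : {set {set 'I_N}} :=
  [set F in D | face_dim F <= m].

Definition faces (D : {set {set 'I_N}}) (p : int) : {set {set 'I_N}} :=
  [set F in D | face_dim F == p].

Definition incidence (F G : {set 'I_N}) : K :=
  \sum_(v in F | G == F :\ v) (-1) ^+ #|[set u in F | (u < v)%N]|.

(* The matrix, acting on row vectors, of the boundary map from p-chains to
   q-chains; meant for q = p - 1. *)
Definition boundary (D : {set {set 'I_N}}) (p q : int) :
    'M[K]_(#|faces D p|, #|faces D q|) :=
  \matrix_(i, j) incidence (enum_val i) (enum_val j).

(* dim (cycles) - dim (boundaries) in degree p; degree -1 is spanned by the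
   empty face, if present. *)
Definition rhomology_dim (D : {set {set 'I_N}}) (p : int) : nat :=
  (\rank (kermx (boundary D p (p - 1))) - \rank (boundary D (p + 1) p))%N.

End Simplicial.

Definition lev n (b c : 'rV[int]_n) : bool := [forall i, b 0 i <= c 0 i].

Definition absv n (c : 'rV[int]_n) : int := \sum_(i < n) c 0 i.

(* A set F of indices stands for the set {a_i : i in F} of exponents. *)
Definition pile n d (a : enumeration n d) (c : 'rV[int]_n) :
    {set {set 'I_(num_exps n d)}} :=
  [set F : {set _} | lev (\sum_(i in F) en_deg a i) c].

(* Main.v *)
Require Import Defs.
From HB Require Import structures.
From mathcomp Require Import all_boot all_order all_algebra.
From mathcomp Require Import freeg mpoly ring.

Set Implicit Arguments.
Unset Strict Implicit.
Unset Printing Implicit Defensive.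

Import GRing.Theory Num.Theory.
Local Open Scope ring_scope.

(** Tor is symmetric: the Betti numbers of a graded module M are also the
homology dimensions of M tensored with the Koszul complex of y_1, ..., y_N.  In
degree c the latter has, for M = S_{n,d,k}, one basis vector for each F such
that c - \sum_{a in F} a is the exponent of a monomial of M, that is for each
face F of the pile complex with at most j elements, and the Koszul differential
is the simplicial boundary.  The symmetry is obtained by dimension shifting
along a given free resolution, whose terms have acyclic Koszul complexes.  The
isomorphisms between homology spaces are linear correspondences, so that no
choice of liftings has to be made. *)

(** * Isomorphisms of subquotients given by linear relations *)

Section SubquotientIso.

Variable K : pzRingType.

(** [T] is a linear relation with domain [Z] and range [Z']. Two partners of the same element differ
    by a partner of 0, so the last clause makes [T] induce an isomorphism from Z/B to Z'/B'. The
    scalings are arguments because Tor is a K-space, whereas K acts on Koszul chains through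
    constant polynomials. *)
Definition subquo_iso (E E' : zmodType) (s : K -> E -> E) (s' : K -> E' -> E')
    (Z B : E -> Prop) (Z' B' : E' -> Prop) : Prop :=
  exists T : E -> E' -> Prop,
    [/\ T 0 0,
        forall a x x' y y', T x x' -> T y y' -> T (x + s a y) (x' + s' a y'),
        forall z, Z z -> exists z', T z z',
        forall z', Z' z' -> exists z, T z z' &
        forall x x', T x x' -> [/\ Z x, Z' x' & B x <-> B' x']].

Lemma subquo_iso_sym (E E' : zmodType) s s' (Z B : E -> Prop)
    (Z' B' : E' -> Prop) :
  subquo_iso s s' Z B Z' B' -> subquo_iso s' s Z' B' Z B.
Proof.
case=> T [T0 TD TZ TZ' TB]; exists (fun x' x => T x x'); split=> //.
  by move=> a x x' y y'; apply: TD.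
by move=> x x' /TB[? ? ?]; split=> //; apply: iff_sym.
Qed.

Lemma subquo_iso_trans (E1 E2 E3 : zmodType) s1 s2 s3 (Z1 B1 : E1 -> Prop)
    (Z2 B2 : E2 -> Prop) (Z3 B3 : E3 -> Prop) :
  subquo_iso s1 s2 Z1 B1 Z2 B2 -> subquo_iso s2 s3 Z2 B2 Z3 B3 ->
  subquo_iso s1 s3 Z1 B1 Z3 B3.
Proof.
case=> T [T0 TD TZ TZ' TB] [U [U0 UD UZ UZ' UB]].
exists (fun x z => exists2 y, T x y & U y z); split.
- by exists 0.
- move=> a x x' y y' [p Txp Upx'] [q Tyq Uqy'].
  by exists (p + s2 a q); [apply: TD | apply: UD].
- by move=> z /TZ[y Tzy]; have [_ /UZ[x Uyx] _] := TB _ _ Tzy; exists x, y.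
- by move=> z /UZ'[y Uyz]; have [/TZ'[x Txy] _ _] := UB _ _ Uyz; exists x, y.
move=> x z [y /TB[Zx _ BB] /UB[_ Zz BB']]; split=> //.
exact: iff_trans BB BB'.
Qed.

Lemma eq_subquo_iso (E E' : zmodType) s s' (Z1 Z2 B : E -> Prop)
    (Z' B' : E' -> Prop) :
  (forall x, Z1 x <-> Z2 x) ->
  subquo_iso s s' Z1 B Z' B' -> subquo_iso s s' Z2 B Z' B'.
Proof.
move=> eqZ [T [T0 TD TZ TZ' TB]]; exists T; split=> //.
  by move=> z /eqZ/TZ.
by move=> x x' /TB[/eqZ ? ? ?].
Qed.

End SubquotientIso.

Lemma subquo_iso_dim (K : fieldType) (E E' : lmodType K) (Z B : E -> Prop)
    (Z' B' : E' -> Prop) m :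
  subquo_iso (fun a (x : E) => a *: x) (fun a (x : E') => a *: x) Z B Z' B' ->
  quotient_dim Z' B' m -> quotient_dim Z B m.
Proof.
case=> T [T0 TD TZ TZ' TB] [v' [Zv' hv']].
have /fin_all_exists[v Tv] i : exists x, T x (v' i) by apply: TZ'.
have Tsum (a : {ffun 'I_m -> K}) :
    T (\sum_(i < m) a i *: v i) (\sum_(i < m) a i *: v' i).
  elim/big_ind2: _ => // [x x' y y' Tx Ty|i _].
    by have := TD 1 _ _ _ _ Tx Ty; rewrite !scale1r.
  by have := TD (a i) _ _ _ _ T0 (Tv i); rewrite !add0r.
exists v; split=> [i|z /TZ[z' Tz]]; first by case: (TB _ _ (Tv i)).
have [_ Zz' _] := TB _ _ Tz; have [a [Ba ua]] := hv' z' Zz'.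
have BB (e : {ffun 'I_m -> K}) :
    B (z - \sum_(i < m) e i *: v i) <-> B' (z' - \sum_(i < m) e i *: v' i).
  have := TD (-1) _ _ _ _ Tz (Tsum e); rewrite !scaleN1r.
  by case/TB.
by exists a; split=> [|e /BB]; [apply/BB | apply: ua].
Qed.

(** * The Koszul complex of an R-module *)

Section Koszul.

Variables (K : fieldType) (N : nat).

Local Notation R := {mpoly K[N]}.

(** For v outside G, the sign of sorting e_v /\ e_G into e_{v |: G}. *)
Definition ksign (S : pzRingType) (v : 'I_N) (G : {set 'I_N}) : S :=
  (-1) ^+ #|[set u in G | (u < v)%N]|.

Lemma ksignU1 (S : pzRingType) (v w : 'I_N) (G : {set 'I_N}) : w \notin G ->
  ksign S v (w |: G) = (-1) ^+ (w < v)%N * ksign S v G.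
Proof.
move=> wG; rewrite /ksign -exprD; congr (_ ^+ _).
have -> : [set u in w |: G | (u < v)%N] =
    (if (w < v)%N then w |: [set u in G | (u < v)%N]
     else [set u in G | (u < v)%N]).
  apply/setP=> u; case: ifP => wv; rewrite !inE.
    by case: (u =P w) => [->|]; rewrite ?wv.
  by case: (u =P w) => [->|]; rewrite ?wv ?andbF.
by case: ifP => wv; rewrite ?cardsU1 ?inE ?(negPf wG).
Qed.

(** Antisymmetry of e_v /\ e_w: exactly one of v < w and w < v holds, and it contributes the
    additional sign. *)
Lemma ksign_swap (S : pzRingType) (v w : 'I_N) (G : {set 'I_N}) :
    v != w -> v \notin G -> w \notin G ->
  ksign S v G * ksign S w (v |: G) = - (ksign S w G * ksign S v (w |: G)).
Proof.
move=> vw vG wG; rewrite !ksignU1 // /ksign -!exprD -[RHS]mulN1r -exprS.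
rewrite -[LHS]signr_odd -[RHS]signr_odd oddS !oddD !oddb -addTb.
congr (_ ^+ nat_of_bool _).
have : (v < w)%N (+) (w < v)%N.
  by case: ltngtP (vw) => // /val_inj ->; rewrite eqxx.
by case: (v < w)%N (w < v)%N => [] [] //= _; do 2!case: (odd _).
Qed.

Lemma ksignK (S : pzRingType) (v : 'I_N) (G : {set 'I_N}) :
  ksign S v G * ksign S v G = 1.
Proof. by rewrite /ksign -exprD addnn -signr_odd odd_double. Qed.

Local Notation kos M := {ffun {set 'I_N} -> M}.

Section Differential.

Variable M : lmodType R.

(** A chain [u] stands for \sum_G u(G) e_G, all homological degrees together. The differential is
    written by target: the coefficient at G collects what comes from each e_{v |: G}. *)
Definition kosd (u : kos M) : kos M :=
  [ffun G : {set 'I_N} =>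
     \sum_(v | v \notin G) ksign R v G *: ('X_v *: u (v |: G))].

Lemma kosd_is_linear : linear kosd.
Proof.
move=> p u u'; apply/ffunP => G; rewrite !ffunE scaler_sumr -big_split /=.
apply: eq_bigr => v _; rewrite !ffunE !scalerDr !scalerA.
by rewrite [in LHS](mulrC _ p) mulrA [p * _ * _]mulrAC -!mulrA.
Qed.

HB.instance Definition _ :=
  GRing.isLinear.Build R (kos M) (kos M) _ kosd kosd_is_linear.

Lemma kosdK (u : kos M) : kosd (kosd u) = 0.
Proof.
apply/ffunP => G; rewrite !ffunE.
pose t (v w : 'I_N) := (ksign R v G * ksign R w (v |: G)) *:
   (('X_v * 'X_w) *: u (w |: (v |: G))).
have -> : \sum_(v | v \notin G) ksign R v G *: ('X_v *: kosd u (v |: G)) =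
    \sum_(v | v \notin G) \sum_(w | w \notin v |: G) t v w.
  apply: eq_bigr => v vG; rewrite !ffunE !scaler_sumr; apply: eq_bigr => w _.
  by rewrite /t !scalerA !mulrA [_ * 'X_v * _]mulrAC.
have tN v w : v != w -> v \notin G -> w \notin G -> t v w = - t w v.
  by move=> vw vG wG; rewrite /t ksign_swap // scaleNr setUCA ['X_v * _]mulrC.
(* Split the pairs (v, w) by their order: swapping v and w exchanges the two halves and changes the
   sign of [t]. *)
have -> : \sum_(v | v \notin G) \sum_(w | w \notin v |: G) t v w =
    \sum_(v | v \notin G) \sum_(w | (w \notin G) && (v < w)%N) t v w +
    \sum_(v | v \notin G) \sum_(w | (w \notin G) && (w < v)%N) t v w.
  rewrite -big_split; apply: eq_bigr => v vG /=.
  rewrite (bigID (fun w : 'I_N => (v < w)%N)) /=; congr (_ + _);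
    apply: eq_bigl => w.
    rewrite !inE; case: (w \in G); rewrite ?orbT // orbF.
    by case: eqVneq => // ->; rewrite ltnn.
  rewrite !inE negb_or -leqNgt [(w < v)%N]ltn_neqAle.
  by rewrite [_ && (w \notin G)]andbC andbA.
rewrite [X in _ + X](exchange_big_dep (fun w => w \notin G)) /=; last first.
  by move=> v w _ /andP[].
rewrite -big_split big1 //= => v vG.
apply/eqP; rewrite addr_eq0 -sumrN; apply/eqP.
apply: eq_big => [w|w /andP[wG vw]]; first by rewrite vG.
by apply: tN => //; apply: contraTneq vw => ->; rewrite ltnn.
Qed.

End Differential.

Definition kosmap (M M' : lmodType R) (f : M -> M') (u : kos M) : kos M' :=
  [ffun G : {set 'I_N} => f (u G)].

Lemma kosmap_is_linear (M M' : lmodType R) (f : {linear M -> M'}) :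
  linear (kosmap f).
Proof. by move=> p u u'; apply/ffunP => G; rewrite !ffunE linearP. Qed.

HB.instance Definition _ (M M' : lmodType R) (f : {linear M -> M'}) :=
  GRing.isLinear.Build R (kos M) (kos M') _ (kosmap f) (kosmap_is_linear f).

Lemma kosmap_d (M M' : lmodType R) (f : {linear M -> M'}) (u : kos M) :
  kosmap f (kosd u) = kosd (kosmap f u).
Proof.
apply/ffunP => G; rewrite !ffunE linear_sum; apply: eq_bigr => v _.
by rewrite ffunE [LHS]linearZ [f ('X_v *: _)]linearZ.
Qed.

End Koszul.

(** * Multigraded pieces of the Koszul complex *)

Section GradedKoszul.

Variables (K : fieldType) (n N : nat) (w : 'I_N -> 'rV[int]_n).

Local Notation R := {mpoly K[N]}.
Local Notation V := 'rV[int]_n.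
Local Notation kos M := {ffun {set 'I_N} -> M}.

HB.instance Definition _ (M : grmod K w) (c : V) :=
  GRing.isZmodClosed.Build M (@gm_comp _ _ _ _ M c) (@gm_compB _ _ _ _ M c).

Lemma wdegU v : wdeg w U_(v)%MM = w v.
Proof.
rewrite /wdeg (bigD1 v) //= mnm1E eqxx mulr1n big1 ?addr0 // => u uv.
by rewrite mnm1E eq_sym (negPf uv) mulr0n.
Qed.

Lemma wdeg0 : wdeg w 0%MM = 0.
Proof. by rewrite /wdeg big1 // => i _; rewrite mnm0E mulr0n. Qed.

Lemma whomogX v : ('X_v : R) \in whomog w (w v).
Proof. by rewrite inE msuppX /= wdegU eqxx. Qed.

Lemma whomogC (a : K) : (a%:MP : R) \in whomog w 0.
Proof.
apply/whomogP => m; rewrite mcoeffC; case: (m =P 0%MM) => [-> _|_].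
  exact: wdeg0.
by rewrite mulr0 eqxx.
Qed.

Lemma gm_compZC (M : grmod K w) c (a : K) (x : M) :
  x \in gm_comp (g := M) c -> a%:MP *: x \in gm_comp (g := M) c.
Proof. by move=> xc; rewrite -[c]add0r gm_compZ ?whomogC. Qed.

Lemma gm_compZsign (M : grmod K w) c k (x : M) :
  x \in gm_comp (g := M) c -> ((-1) ^+ k : R) *: x \in gm_comp (g := M) c.
Proof.
move=> xc; have -> : (-1) ^+ k = ((-1) ^+ k : K)%:MP :> R.
  by rewrite rmorphXn rmorphN1.
exact: gm_compZC.
Qed.

(** The component of degree c of any preimage works, since decompositions into homogeneous
    components are unique. *)
Lemma gm_lift (M M' : grmod K w) (f : {linear M -> M'}) c x y :
    gr_morph f -> x \in gm_comp (g := M') c -> x = f y ->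
  exists2 y', y' \in gm_comp (g := M) c & x = f y'.
Proof.
move=> fgr xc xfy; have [s [g [hg yE]]] := gm_span y.
pose h e := \sum_(e' <- s | e' == e) g e'.
have hh e : h e \in gm_comp (g := M) e.
  by apply: rpred_sum => e' /eqP <-.
(* The degree c is put on the list because the decomposition of y may have no component there. *)
pose t := undup (c :: s).
have yE' : y = \sum_(e <- t) h e.
  rewrite yE /h (exchange_big_dep xpredT) //=.
  rewrite [LHS]big_seq [RHS]big_seq; apply: eq_bigr => e es.
  rewrite big_mkcond (bigD1_seq e) ?undup_uniq //=; last first.
    by rewrite mem_undup inE es orbT.
  by rewrite eqxx big1 ?addr0 // => e'; rewrite eq_sym => /negPf ->.
have ct : c \in t by rewrite mem_undup mem_head.
exists (h c); first exact: hh.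
apply/esym/eqP; rewrite -subr_eq0; apply/eqP.
have := @gm_direct _ _ _ _ M' t (fun e => f (h e) - (if e == c then x else 0)).
move/(_ (undup_uniq _)) => /=.
have gh e : f (h e) - (if e == c then x else 0) \in gm_comp (g := M') e.
  by rewrite rpredB ?fgr ?hh //; case: eqP => [->|_] //; apply: rpred0.
move/(_ gh); rewrite sumrB -raddf_sum -yE' xfy.
rewrite [X in _ - X](bigD1_seq c) ?undup_uniq //= eqxx big1 ?addr0;
  last by move=> e /negPf->.
by rewrite subrr => /(_ erefl c ct); rewrite eqxx.
Qed.

Definition wset (G : {set 'I_N}) : V := \sum_(v in G) w v.

(** The basis vector e_G has degree [wset G]; the second clause places [u] in homological degree
    i. *)
Definition kos_homog (M : grmod K w) (i : nat) (c : V) (u : kos M) : Prop :=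
  forall G, u G \in gm_comp (g := M) (c - wset G) /\ (#|G| != i -> u G = 0).

Section Homogeneous.

Variables (M : grmod K w) (i : nat) (c : V).

Lemma kos_homog0 : @kos_homog M i c 0.
Proof. by move=> G; rewrite ffunE; split=> //; apply: rpred0. Qed.

Lemma kos_homogB (u u' : kos M) :
  kos_homog i c u -> kos_homog i c u' -> kos_homog i c (u - u').
Proof.
move=> hu hu' G; have [uG uG0] := hu G; have [uG' uG0'] := hu' G.
rewrite !ffunE; split; first exact: rpredB.
by move=> Gi; rewrite uG0 ?uG0' ?subrr.
Qed.

Lemma kos_homog_axpy (a : K) (u u' : kos M) :
  kos_homog i c u -> kos_homog i c u' -> kos_homog i c (u + a%:MP *: u').
Proof.
move=> hu hu' G; have [uG uG0] := hu G; have [uG' uG0'] := hu' G.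
rewrite !ffunE; split; first by rewrite rpredD ?gm_compZC.
by move=> Gi; rewrite uG0 ?uG0' ?scaler0 ?addr0.
Qed.

Lemma kos_homogD (u u' : kos M) :
  kos_homog i c u -> kos_homog i c u' -> kos_homog i c (u + u').
Proof. by move=> hu /(kos_homog_axpy 1 hu); rewrite scale1r. Qed.

Lemma kos_homog_d (u : kos M) : kos_homog i.+1 c u -> kos_homog i c (kosd u).
Proof.
move=> hu G; rewrite ffunE; split=> [|Gi]; last first.
  rewrite big1 // => v vG; have [_ ->] := hu (v |: G); first by rewrite !scaler0.
  by rewrite cardsU1 vG add1n eqSS.
apply: rpred_sum => v vG; apply: gm_compZsign.
have -> : c - wset G = w v + (c - wset (v |: G)).
  by rewrite /wset big_setU1 //= opprD addrCA addNKr.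
by apply: gm_compZ; [apply: whomogX | case: (hu (v |: G))].
Qed.

End Homogeneous.

Lemma kosd_homog0 (M : grmod K w) c (u : kos M) : kos_homog 0 c u -> kosd u = 0.
Proof.
move=> hu; apply/ffunP => G; rewrite !ffunE big1 // => v vG.
by have [_ ->] := hu (v |: G); rewrite ?scaler0 // cardsU1 vG.
Qed.

Lemma kos_homog_map (M M' : grmod K w) (f : {linear M -> M'}) i c (u : kos M) :
  gr_morph f -> kos_homog i c u -> kos_homog i c (kosmap f u).
Proof.
move=> fgr hu G; have [uG uG0] := hu G; rewrite ffunE; split; first exact: fgr.
by move=> /uG0->; rewrite raddf0.
Qed.

Lemma kos_lift (M M' : grmod K w) (f : {linear M -> M'}) i c (u : kos M') :
    gr_morph f -> kos_homog i c u -> (forall G, exists y, u G = f y) ->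
  exists2 u', kos_homog i c u' & kosmap f u' = u.
Proof.
move=> fgr hu uf.
have /fin_all_exists[g hg] G : exists y : M,
    [/\ y \in gm_comp (g := M) (c - wset G), #|G| != i -> y = 0 & f y = u G].
  have [uG uG0] := hu G; have [Gi|Gi] := eqVneq #|G| i.
    by have [y /(gm_lift fgr uG)[y' y'c ->]] := uf G; exists y'.
  by exists 0; rewrite raddf0 uG0 //; split=> //; apply: rpred0.
exists [ffun G => g G] => [G|].
  by rewrite ffunE; case: (hg G).
by apply/ffunP => G; rewrite !ffunE; case: (hg G).
Qed.

End GradedKoszul.

(** * Division by a variable and a homotopy on the Koszul complex of a free module *)

Lemma coeff_sumU (R : nzRingType) (B : choiceType) (s : seq B) (f : B -> R) b :
  uniq s ->
  coeff b (\sum_(b' <- s) << f b' *g b' >>) = if b \in s then f b else 0.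
Proof.
move=> us; rewrite raddf_sum /=; under eq_bigr do rewrite coeffU.
case: ifPn => bs.
  rewrite (bigD1_seq b) //= eqxx mulr1 big1 ?addr0 // => b' /negPf ->.
  by rewrite mulr0.
rewrite big_seq big1 // => b' b's; case: eqP => [E|_]; last by rewrite mulr0.
by rewrite E (negPf bs) in b's.
Qed.

Section Contraction.

Variables (K : fieldType) (N : nat).

Local Notation R := {mpoly K[N]}.
Local Notation kos M := {ffun {set 'I_N} -> M}.

(* The quotient of p - p|_{y_v = 0} by y_v. *)
Definition mdivX (v : 'I_N) (p : R) : R :=
  \sum_(m <- msupp p | (0 < m v)%N) p@_m *: 'X_[m - U_(v)].

Lemma mcoeff_mdivX v p m : (mdivX v p)@_m = p@_(m + U_(v)).
Proof.
rewrite /mdivX raddf_sum /=; under eq_bigr do rewrite mcoeffZ mcoeffX.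
have mE (m' : 'X_{1..N}) : (0 < m' v)%N ->
    ((m' - U_(v))%MM == m) = (m' == m + U_(v))%MM.
  move=> m'v; apply/eqP/eqP => [<-|->]; last exact: addmK.
  by rewrite submK //; apply/mnm_lepP => u; rewrite mnm1E; case: eqP => // <-.
have [mp|mp] := boolP ((m + U_(v))%MM \in msupp p); last first.
  rewrite (memN_msupp_eq0 mp) big_seq_cond big1 // => m' /andP[m'p m'v].
  by rewrite mE //; case: eqP => [E|_]; rewrite ?mulr0 // -E m'p in mp *.
rewrite big_mkcond (bigD1_seq (m + U_(v))%MM) ?msupp_uniq //=.
rewrite mnmDE mnm1E eqxx addn1 addmK eqxx mulr1 big1 ?addr0 // => m' /negPf mm'.
by case: ifP => // /mE ->; rewrite mm' mulr0.
Qed.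

Section Free.

Variable B : choiceType.

Local Notation F := {freeg B / R}.

Definition fcoef (b : B) (m : 'X_{1..N}) (x : F) : K := (coeff b x)@_m.

Lemma fcoefP (x y : F) : (forall b m, fcoef b m x = fcoef b m y) -> x = y.
Proof.
by move=> xy; apply/eqP/freeg_eqP => b; apply/mpolyP => m; apply: xy.
Qed.

Lemma fcoefB b m x y : fcoef b m (x - y) = fcoef b m x - fcoef b m y.
Proof. by rewrite /fcoef coeffB mcoeffB. Qed.

HB.instance Definition _ b m :=
  GRing.isZmodMorphism.Build F K (fcoef b m) (fcoefB b m).

Lemma fcoefXZ b m v x :
  fcoef b m ('X_v *: x) = if (0 < m v)%N then fcoef b (m - U_(v))%MM x else 0.
Proof.
rewrite /fcoef coeffZ mulrC; case: ifP => mv.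
  rewrite -[m in LHS](@submK _ U_(v)%MM) ?mcoeffMX // 1?addmC ?mcoeffMX //.
  by apply/mnm_lepP => u; rewrite mnm1E; case: eqP => // <-.
apply/eqP; rewrite mcoeff_eq0; apply/negP.
move=> /msuppM_le /allpairsP[[m1 m2] /= []].
by rewrite msuppX inE => _ /eqP-> E; rewrite E mnmDE mnm1E eqxx addn1 in mv.
Qed.

Definition fdiv (v : 'I_N) (x : F) : F :=
  \sum_(b <- dom x) << mdivX v (coeff b x) *g b >>.

Lemma coeff_fdiv b v x : coeff b (fdiv v x) = mdivX v (coeff b x).
Proof.
rewrite /fdiv coeff_sumU ?uniq_dom //; case: ifPn => // /coeff_outdom->.
by apply/mpolyP => m; rewrite mcoeff_mdivX !mcoeff0.
Qed.

Lemma fcoef_fdiv b m v x : fcoef b m (fdiv v x) = fcoef b (m + U_(v))%MM x.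
Proof. by rewrite /fcoef coeff_fdiv mcoeff_mdivX. Qed.

Lemma fdiv_is_additive v : zmod_morphism (fdiv v).
Proof. by move=> x y; apply: fcoefP => b m; rewrite !(fcoefB, fcoef_fdiv). Qed.

HB.instance Definition _ v :=
  GRing.isZmodMorphism.Build F F (fdiv v) (fdiv_is_additive v).

Lemma fdivX v x : fdiv v ('X_v *: x) = x.
Proof.
apply: fcoefP => b m.
by rewrite fcoef_fdiv fcoefXZ mnmDE mnm1E eqxx addn1 addmK.
Qed.

Lemma fdivXC v u x : u != v -> fdiv v ('X_u *: x) = 'X_u *: fdiv v x.
Proof.
move=> uv; apply: fcoefP => b m.
rewrite fcoef_fdiv !fcoefXZ fcoef_fdiv mnmDE mnm1E.
rewrite [v == u]eq_sym (negPf uv) addn0.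
case: ifP => // mu; congr (fcoef b _ x); apply/mnmP => j.
rewrite !(mnmDE, mnmBE, mnm1E).
case: (u =P j) => [<-|_]; last by rewrite !subn0.
by rewrite eq_sym (negPf uv) !addn0.
Qed.

Lemma fdiv_sign v u (G : {set 'I_N}) x :
  fdiv v (ksign R u G *: x) = ksign R u G *: fdiv v x.
Proof. exact: raddfZsign. Qed.

(* The homotopy e_v /\ (division by y_v) contracts the complex onto the part with
   y_v = 0 and e_v absent, whence acyclicity variable by variable. *)
Definition kos_htpy (v : 'I_N) (u : kos F) : kos F :=
  [ffun G : {set 'I_N} =>
     if v \in G then ksign R v (G :\ v) *: fdiv v (u (G :\ v)) else 0].

Definition kos_rest (v : 'I_N) (u : kos F) : kos F :=
  [ffun G : {set 'I_N} =>
     if v \in G then 0 else u G - 'X_v *: fdiv v (u G)].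

(** Write d for [kosd] and h for [kos_htpy v]. If v is not in G, only the summand of index v
    survives in d h u, and it is the part of u(G) divisible by y_v. If v is in G, the summand v of h
    d u is u(G), and the others cancel against d h u by antisymmetry of the signs. *)
Lemma kos_homotopy v (u : kos F) :
  kosd (kos_htpy v u) + kos_htpy v (kosd u) = u - kos_rest v u.
Proof.
apply/ffunP => G; rewrite !ffunE; have [vG|vG] := boolP (v \in G); last first.
  rewrite addr0 opprB addrC subrK (bigD1 v) //= !ffunE setU11 setU1K //.
  rewrite !scalerA mulrAC ksignK mul1r big1 ?addr0 // => x /andP[xG xv].
  by rewrite ffunE !inE eq_sym (negPf xv) (negPf vG) !scaler0.
rewrite subr0 [fdiv v _]raddf_sum scaler_sumr /=.
rewrite [X in _ + X](bigD1 v) ?setD11 //= setD1K //.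
rewrite fdiv_sign fdivX scalerA ksignK scale1r addrCA.
rewrite -[RHS]addr0; congr (_ + _).
rewrite [X in _ + X](eq_bigl (fun x => x \notin G)).
  rewrite -big_split big1 //= => x xG; rewrite ffunE inE vG orbT.
  have xv : x != v by apply: contraNneq xG => ->.
  have -> : (x |: G) :\ v = x |: G :\ v.
    apply/setP => y; rewrite !inE; case: eqVneq => // ->.
    by rewrite eq_sym (negPf xv).
  rewrite fdiv_sign fdivXC // !scalerA -scalerDl.
  have xG' : x \notin G :\ v by rewrite !inE negb_and xG orbT.
  have := @ksign_swap _ R x v (G :\ v) xv xG' (negbT (setD11 _ _)).
  rewrite setD1K // => E; apply/eqP; rewrite -[ksign R v (x |: _)]mul1r.
  (* The inserted square of a sign completes a product to which the swap rule [E] applies. *)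
  rewrite -(ksignK R x (G :\ v)) -[_ * _ * ksign R v _]mulrA E.
  set p := ksign R x G; set q := ksign R v _; set r := ksign R x _.
  have -> : p * 'X_x * (r * - (q * p)) = - ((p * p) * (q * r * 'X_x)) by ring.
  by rewrite ksignK mul1r addNr scale0r.
by move=> x; rewrite !inE; case: eqVneq => [->|] //=; rewrite ?vG ?andbT.
Qed.

End Free.

End Contraction.

(** * Acyclicity of the Koszul complex of a free module *)

Section FreeAcyclicity.

Variables (K : fieldType) (n N : nat) (w : 'I_N -> 'rV[int]_n).
Variable F : gfree n.

Local Notation R := {mpoly K[N]}.
Local Notation FM := {freeg (gbasis F) / R}.
Local Notation FG := (free_grmod K w F).
Local Notation kos M := {ffun {set 'I_N} -> M}.

Lemma free_comp_fcoefP c (x : FM) : reflect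
  (forall b m, fcoef b m x != 0 -> wdeg w m + gdeg b = c) (x \in free_comp w c).
Proof.
apply: (iffP (@free_compP K n N w F c x)) =>
  [h b m /(whomogP w _ _ (h b)) ->|h b].
  by rewrite subrK.
by apply/whomogP => m /h <-; rewrite addrK.
Qed.

Lemma fdiv_homog v c (x : FM) :
  x \in free_comp w c -> fdiv v x \in free_comp w (c - w v).
Proof.
move=> /free_comp_fcoefP hx; apply/free_comp_fcoefP => b m.
by rewrite fcoef_fdiv => /hx <-; rewrite wdegD wdegU addrAC addrK.
Qed.

Lemma kos_htpy_homog v i c (u : kos FM) :
  kos_homog (M := FG) i c u -> kos_homog (M := FG) i.+1 c (kos_htpy v u).
Proof.
move=> hu G; have [uG uG0] := hu (G :\ v).
rewrite ffunE; have [vG|vG] := ifP; last by split=> //; apply: rpred0.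
split=> [|Gi].
  apply: gm_compZsign.
  have -> : c - wset w G = c - wset w (G :\ v) - w v.
    by rewrite -addrA -opprD /wset [in LHS](big_setD1 v) //= addrC.
  exact: fdiv_homog.
rewrite uG0 ?raddf0 ?scaler0 //.
by apply: contraNneq Gi => Gi; rewrite (cardsD1 v) vG Gi.
Qed.

Lemma kos_rest_homog v i c (u : kos FM) :
  kos_homog (M := FG) i c u -> kos_homog (M := FG) i c (kos_rest v u).
Proof.
move=> hu G; have [uG uG0] := hu G.
rewrite ffunE; case: ifP => vG; first by split=> //; apply: rpred0.
split=> [|/uG0->]; last by rewrite raddf0 scaler0 subrr.
apply: rpredB => //; rewrite -[c - _](subrK (w v)) addrC.
by apply: (@gm_compZ _ _ _ _ FG); [apply: whomogX | apply: fdiv_homog].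
Qed.

Lemma fcoef_kos_rest v (u : kos FM) G b m :
  fcoef b m (kos_rest v u G) =
  if (v \in G) || (0 < m v)%N then 0 else fcoef b m (u G).
Proof.
rewrite ffunE; case: ifP => vG /=; first by rewrite raddf0.
rewrite fcoefB fcoefXZ fcoef_fdiv; case: ifP => mv; last by rewrite subr0.
rewrite submK ?subrr //.
by apply/mnm_lepP => j; rewrite mnm1E; case: eqP => // <-.
Qed.

Lemma fcoef0_kosd (u : kos FM) G b : fcoef b 0%MM (kosd u G) = 0.
Proof.
rewrite ffunE raddf_sum big1 //= => v vG.
by rewrite scalerA mulrC -scalerA fcoefXZ mnm0E.
Qed.

(** Induction over the variables: the homotopy for v changes a cycle by a boundary into one
    involving neither y_v nor e_v. Passing to [kos_rest] only deletes coefficients, so the vanishing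
    obtained for earlier variables persists. *)
Lemma kos_free_reduce (s : seq 'I_N) i c (u : kos FM) :
    kos_homog (M := FG) i c u -> kosd u = 0 ->
  exists u' u'' : kos FM,
    [/\ kos_homog (M := FG) i.+1 c u', kos_homog (M := FG) i c u'',
        u = u'' + kosd u' &
        forall v (G : {set 'I_N}) b (m : 'X_{1..N}), v \in s ->
          (v \in G) || (0 < m v)%N -> fcoef b m (u'' G) = 0].
Proof.
move=> hu du; elim: s => [|v s [u' [u'' [hu' hu'' uE hs]]]].
  by exists 0, u; rewrite raddf0 addr0; split=> //; apply: kos_homog0.
have du'' : kosd u'' = 0.
  by move/(congr1 (@kosd _ _ _)): uE; rewrite raddfD /= kosdK addr0 du.
exists (u' + kos_htpy v u''), (kos_rest v u''); split.
- by apply: kos_homogD => //; apply: kos_htpy_homog.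
- exact: kos_rest_homog.
(* As u'' is a cycle, the term h d u'' vanishes, and u'' differs from its rest by the boundary of h
   u''. *)
- have := kos_homotopy v u''; have -> : kos_htpy v (kosd u'') = 0.
    by rewrite du''; apply/ffunP => G; rewrite !ffunE raddf0 scaler0 if_same.
  by rewrite addr0 uE raddfD /= => ->; rewrite addrCA subrKC addrC.
move=> x G b m; rewrite inE fcoef_kos_rest => /orP[/eqP->|xs] h.
  by rewrite h.
by case: ifP => // _; apply: hs h.
Qed.

(** After reduction in all variables only constant coefficients at G = set0 are left. Boundaries
    have none, so these are the ones of [u], which vanish by hypothesis. In degree 0 that hypothesis
    says that u(set0) lies in (y_1, ..., y_N)F. *)
Lemma kos_free_acyclic i c (u : kos FM) :
    kos_homog (M := FG) i c u -> kosd u = 0 ->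
    (forall b, fcoef b 0%MM (u set0) = 0) ->
  exists2 u', kos_homog (M := FG) i.+1 c u' & u = kosd u'.
Proof.
move=> hu du u0.
have [u' [u'' [hu' _ uE hs]]] := kos_free_reduce (enum 'I_N) hu du.
exists u' => //; rewrite uE [X in X + _](_ : _ = 0) ?add0r //.
apply/ffunP => G; apply: fcoefP => b m; rewrite ffunE raddf0.
have [->|[v vG]] := set_0Vmem G; last by apply: (hs v); rewrite ?mem_enum ?vG.
have [->|[v mv]] : m = 0%MM \/ exists v, (0 < m v)%N.
  have [/existsP[v mv]|h] := boolP [exists v, (0 < m v)%N].
    by right; exists v.
  left; apply/mnmP => v; rewrite mnm0E; apply/eqP; rewrite -leqn0 leqNgt.
  by apply: contraNN h => mv; apply/existsP; exists v.
  by have := u0 b; rewrite uE ffunE raddfD /= fcoef0_kosd addr0.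
by apply: (hs v); rewrite ?mem_enum ?mv ?orbT.
Qed.

End FreeAcyclicity.

(** * Cycles with coefficients in a submodule, and dimension shifting *)

Section Subquotients.

Variables (K : fieldType) (n N : nat) (w : 'I_N -> 'rV[int]_n).

Local Notation R := {mpoly K[N]}.
Local Notation kos M := {ffun {set 'I_N} -> M}.

Definition polyC_scale (M : lmodType R) (a : K) (x : M) : M := a%:MP *: x.

Section Cycles.

Variables (M : grmod K w) (Q : M -> Prop) (i : nat) (c : 'rV[int]_n).

(** [Q] stands for a graded submodule such as a syzygy; restricting coefficients inside the ambient
    complex avoids building the submodule as a [grmod]. *)
Definition kos_cycle (u : kos M) : Prop :=
  [/\ kos_homog i c u, forall G, Q (u G) & kosd u = 0].

Definition kos_boundary (u : kos M) : Prop :=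
  exists2 u' : kos M,
    kos_homog i.+1 c u' /\ (forall G, Q (u' G)) & u = kosd u'.

(** These represent the kernel of H_i(Q) -> H_i(M). For M free this is all of H_i(Q) if i > 0, while
    for i = 0 it is the kernel of Q/mQ -> M/mM, with m = (y_1, ..., y_N). *)
Definition kos_null_cycle (u : kos M) : Prop :=
  [/\ kos_homog i c u, forall G, Q (u G) &
      exists2 u' : kos M, kos_homog i.+1 c u' & u = kosd u'].

End Cycles.

Definition kos_iso (M M' : grmod K w) :=
  @subquo_iso K (kos M) (kos M')
    (@polyC_scale (kos M)) (@polyC_scale (kos M')).

Lemma kos_null_cycleS (F : gfree n) (Q : free_grmod K w F -> Prop) i c u :
  kos_null_cycle Q i.+1 c u <-> kos_cycle Q i.+1 c u.
Proof.
split=> [[hu Qu [u' _ uE]]|[hu Qu du]]; first by split=> //; rewrite uE kosdK.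
split=> //; apply: (kos_free_acyclic hu du) => b.
by have [_ ->] := hu set0; rewrite ?cards0 // raddf0.
Qed.

(* Connecting homomorphism of 0 -> ker f -> F -> Q -> 0: the Koszul complex of
   F is exact in positive degrees. *)
Lemma kos_shift (M : grmod K w) (Q : M -> Prop) (F : gfree n)
    (f : {linear free_grmod K w F -> M}) i c :
    gr_morph f -> (forall x, Q x <-> exists y, x = f y) ->
  kos_iso (kos_cycle Q i.+1 c) (kos_boundary Q i.+1 c)
    (kos_null_cycle (fun x => f x = 0) i c)
    (kos_boundary (fun x => f x = 0) i c).
Proof.
move=> fgr Qf.
have ker0 (u : kos (free_grmod K w F)) :
    (forall G, f (u G) = 0) <-> kosmap f u = 0.
  split=> [u0|/ffunP u0 G]; last by have := u0 G; rewrite !ffunE.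
  by apply/ffunP => G; rewrite !ffunE u0.
(* The connecting relation: y lifts z to the free module, and u is the boundary of y. *)
exists (fun z u => exists y : kos (free_grmod K w F),
  [/\ kos_homog i.+1 c y, kosd (kosmap f y) = 0, z = kosmap f y & u = kosd y]).
split.
- by exists 0; rewrite !raddf0; split=> //; apply: kos_homog0.
- move=> a z u z' u' [y [hy dy -> ->]] [y' [hy' dy' -> ->]].
  exists (y + a%:MP *: y'); split; first exact: kos_homog_axpy.
  + rewrite [kosmap f (_ + _)]raddfD /= [kosmap f (_ *: _)]linearZ /=.
    rewrite [kosd _]raddfD /=.
    by rewrite [kosd (_ *: _)]linearZ /= dy dy' scaler0 addr0.
  + by rewrite [kosmap f (_ + _)]raddfD /= [kosmap f (_ *: _)]linearZ.
  + by rewrite [kosd (_ + _)]raddfD /= [kosd (_ *: _)]linearZ.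
- move=> z [hz /(_ _)/Qf Qz dz]; have [y hy yE] := kos_lift fgr hz Qz.
  by exists (kosd y), y; rewrite yE.
- move=> u [hu /ker0 fu [y hy uE]]; exists (kosmap f y), y; split=> //.
  by rewrite -kosmap_d -uE.
move=> z u [y [hy dy -> ->]]; split.
- split=> //; first exact: kos_homog_map.
  by move=> G; apply/Qf; rewrite ffunE; exists (y G).
- by split; [apply: kos_homog_d|apply/ker0; rewrite kosmap_d|exists y].
split=> [[z' [hz' /(_ _)/Qf Qz'] zE]|[y' [hy' /ker0 fy'] yE]].
  (* If z is the boundary of z', subtract from y the boundary of a lift of z': u is unchanged, and
     the coefficients move into ker f. *)
  have [y' hy' y'E] := kos_lift fgr hz' Qz'.
  exists (y - kosd y'); last by rewrite raddfB /= kosdK subr0.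
  split; first by apply: kos_homogB => //; apply: kos_homog_d.
  by apply/ker0; rewrite raddfB /= kosmap_d y'E zE subrr.
(* Conversely, if u is the boundary of y' in ker f, then y - y' is a cycle of positive degree over
   the free module, hence a boundary, and f maps it to z. *)
have hyy' : kos_homog i.+1 c (y - y') by apply: kos_homogB.
have [|b|y'' hy'' y''E] := kos_free_acyclic hyy'.
- by rewrite raddfB /= yE subrr.
- by have [_ ->] := hyy' set0; rewrite ?cards0 // raddf0.
exists (kosmap f y''); last first.
  by rewrite -kosmap_d -y''E raddfB /= fy' subr0.
split; first exact: kos_homog_map.
by move=> G; apply/Qf; rewrite ffunE; exists (y'' G).
Qed.

End Subquotients.

(** * Reduction of free modules modulo the variables *)

Section Tensor.

Variables (K : fieldType) (N : nat) (B : choiceType).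

Local Notation R := {mpoly K[N]}.

Lemma coeff_tensK (b : B) (x : {freeg B / R}) :
  coeff b (tensK x) = fcoef b 0%MM x.
Proof.
rewrite /tensK coeff_sumU ?uniq_dom //; case: ifPn => // /coeff_outdom E.
by rewrite /fcoef E mcoeff0.
Qed.

Lemma tensK_is_additive : zmod_morphism (@tensK K N B).
Proof.
by move=> x y; apply/eqP/freeg_eqP => b; rewrite coeffB !coeff_tensK fcoefB.
Qed.

HB.instance Definition _ :=
  GRing.isZmodMorphism.Build {freeg B / R} {freeg B / K} (@tensK K N B)
    tensK_is_additive.

Lemma tensKZ p (x : {freeg B / R}) : tensK (p *: x) = p@_0%MM *: tensK x.
Proof.
apply/eqP/freeg_eqP => b; rewrite coeffZ !coeff_tensK /fcoef coeffZ.
by rewrite (rmorphM (mcoeff 0%MM)).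
Qed.

Lemma tensK_eq0P (x : {freeg B / R}) :
  tensK x = 0 <-> forall b, fcoef b 0%MM x = 0.
Proof.
split=> [x0 b|x0]; first by rewrite -coeff_tensK x0 coeff0.
by apply/eqP/freeg_eqP => b; rewrite coeff_tensK x0 coeff0.
Qed.

End Tensor.

HB.instance Definition _ (R : nzRingType) (B : choiceType) (M : lmodType R)
    (f : B -> M) :=
  GRing.isZmodMorphism.Build {freeg B / R} M (fglift f) (lift_is_additive f).

Section KoszulDegree0.

Variables (K : fieldType) (n N : nat) (w : 'I_N -> 'rV[int]_n).

Local Notation R := {mpoly K[N]}.
Local Notation kos M := {ffun {set 'I_N} -> M}.

Definition kos0 (M : lmodType R) (x : M) : kos M :=
  [ffun G : {set 'I_N} => if G == set0 then x else 0].

Lemma kos0_is_linear (M : lmodType R) : linear (@kos0 M).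
Proof.
move=> p x y; apply/ffunP => G; rewrite !ffunE.
by case: eqP => // _; rewrite scaler0 addr0.
Qed.

HB.instance Definition _ (M : lmodType R) :=
  GRing.isLinear.Build R M (kos M) _ (@kos0 M) (@kos0_is_linear M).

Lemma kosmap_kos0 (M M' : lmodType R) (f : {linear M -> M'}) x :
  kosmap f (kos0 x) = kos0 (f x).
Proof. by apply/ffunP => G; rewrite !ffunE; case: eqP; rewrite ?raddf0. Qed.

Lemma wset0 : wset w set0 = 0.
Proof. by rewrite /wset big_set0. Qed.

Lemma kos_homog_kos0 (M : grmod K w) c (x : M) :
  x \in gm_comp (g := M) c -> kos_homog 0 c (kos0 x).
Proof.
move=> xc G; rewrite ffunE cards_eq0; case: eqP => [->|_].
  by rewrite wset0 subr0.
by split=> //; apply: rpred0.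
Qed.

Lemma kos_homog0E (M : grmod K w) c (u : kos M) :
  kos_homog 0 c u -> u = kos0 (u set0) /\ u set0 \in gm_comp (g := M) c.
Proof.
move=> hu; split; last by have [] := hu set0; rewrite wset0 subr0.
apply/ffunP => G; rewrite ffunE; case: eqP => [->//|/eqP].
by rewrite -cards_eq0; case: (hu G) => _ h /h.
Qed.

Variable F : gfree n.

Local Notation FM := {freeg (gbasis F) / R}.

(** Koszul boundaries in degree 0 are the elements of (y_1, ..., y_N)F, which is the kernel of
    reduction to constant coefficients. *)
Lemma tensK_eq0 c (x : FM) : x \in free_comp w c ->
  tensK x = 0 <->
  exists2 u : kos FM, kos_homog (M := free_grmod K w F) 1 c u & kos0 x = kosd u.
Proof.
move=> xc; have hx : kos_homog (M := free_grmod K w F) 0 c (kos0 x).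
  exact: kos_homog_kos0.
split=> [/tensK_eq0P x0|[u _ /ffunP/(_ set0)]].
  apply: (kos_free_acyclic hx); first exact: kosd_homog0 hx.
  by move=> b; rewrite ffunE eqxx.
by rewrite ffunE eqxx => ->; apply/tensK_eq0P => b; rewrite fcoef0_kosd.
Qed.

End KoszulDegree0.

(** * Comparison of Tor with Koszul homology *)

Section Tor.

Variables (K : fieldType) (n N : nat) (w : 'I_N -> 'rV[int]_n).
Variables (M : grmod K w) (P : resolution M) (c : 'rV[int]_n).

Local Notation R := {mpoly K[N]}.
Local Notation kos M := {ffun {set 'I_N} -> M}.
Local Notation F i := (free_grmod K w (res_free P i)).

Lemma torK_compP i (x : torK_mod P i) :
  reflect (forall b, coeff b x != 0 -> gdeg b = c) (x \in torK_comp c).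
Proof.
apply: (iffP allP) => h b hb; first by apply/eqP/h; rewrite mem_dom.
by apply/eqP/h; rewrite -mem_dom.
Qed.

Lemma tensK_comp i (x : F i) :
  x \in gm_comp (g := F i) c -> (tensK x : torK_mod P i) \in torK_comp c.
Proof.
move=> /free_comp_fcoefP hx; apply/torK_compP => b.
by rewrite coeff_tensK => /hx <-; rewrite wdeg0 add0r.
Qed.

Lemma tensK_onto i (x : torK_mod P i) : x \in torK_comp c ->
  exists2 y : F i, y \in gm_comp (g := F i) c & x = tensK y.
Proof.
move=> /torK_compP hx.
pose y : {freeg (gbasis (res_free P i)) / R} :=
  \sum_(b <- dom x) << (coeff b x)%:MP *g b >>.
have yE b : coeff b y = (coeff b x)%:MP.
  rewrite /y coeff_sumU ?uniq_dom //; case: ifPn => // /coeff_outdom->.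
  by rewrite rmorph0.
exists y.
  apply/free_comp_fcoefP => b m; rewrite /fcoef yE mcoeffC.
  have [->|/hx->] := eqVneq (coeff b x) 0; first by rewrite mul0r eqxx.
  case: (m =P 0%MM) => [-> _|_]; last by rewrite mulr0 eqxx.
  by rewrite wdeg0 add0r.
by apply/eqP/freeg_eqP => b; rewrite coeff_tensK /fcoef yE mcoeffC eqxx mulr1.
Qed.

Lemma torK_d_tensK i (x : F i.+1) :
  torK_d (tensK x : torK_mod P i.+1) = tensK (res_d P i x).
Proof.
have xE : x = \sum_(b <- dom x) coeff b x *: (<< b >> : F i.+1).
  rewrite -[LHS](freeg_sumE (x : {freeg _ / R})); apply: eq_bigr => b _.
  by apply/eqP/freeg_eqP => b'; rewrite coeffZ !coeffU mul1r.
rewrite [in RHS]xE [res_d P i _]raddf_sum /= [RHS]raddf_sum /= /torK_d.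
rewrite [X in fglift _ X](_ : _ =
  \sum_(b <- dom x) << (coeff b x)@_0%MM *g b >>) // raddf_sum /=.
apply: eq_bigr => b _.
by rewrite liftU [res_d P i (_ *: _)]linearZ /= tensKZ.
Qed.

(** The syzygies, starting with the kernel of the augmentation; by exactness [res_ker i] is the
    image of [res_d P i]. *)
Definition res_ker i : F i -> Prop :=
  match i return F i -> Prop with
  | 0 => fun x => res_aug P x = 0
  | i'.+1 => fun x => res_d P i' x = 0
  end.

Lemma res_kerP i (x : F i) : res_ker x <-> exists y, x = res_d P i y.
Proof. by case: i x => [|i] x; [apply: res_exact0|apply: res_exact]. Qed.

Lemma res_dK i (x : F i.+1) : res_ker (res_d P i x).
Proof. by apply/res_kerP; exists x. Qed.

(** With m = (y_1, ..., y_N), both sides say that x lies in im(d) + m F_i: on the right f x lies in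
    m Q, where Q is the image of f and ker f = im(d). It serves for f the augmentation and for f a
    differential. *)
Lemma tor_boundaryP i (M' : grmod K w) (f : {linear F i -> M'})
    (Q : M' -> Prop) (x : F i) :
    gr_morph f -> (forall y, Q y <-> exists x, y = f x) ->
    (forall x, f x = 0 <-> exists y, x = res_d P i y) ->
    x \in gm_comp (g := F i) c ->
  tor_boundary c (tensK x : torK_mod P i) <-> kos_boundary Q 0 c (kos0 (f x)).
Proof.
move=> fgr Qf fK xc; have dgr := @res_d_graded _ _ _ _ _ P i; split.
  case=> y' /tensK_onto[y yc ->]; rewrite torK_d_tensK => xy.
  have xyc : x - res_d P i y \in gm_comp (g := F i) c.
    by rewrite rpredB //; apply: dgr.
  have fd0 : f (res_d P i y) = 0 by apply/fK; exists y.
  have /(tensK_eq0 xyc)[u hu uE] : tensK (x - res_d P i y) = 0.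
    by rewrite raddfB /= xy subrr.
  exists (kosmap f u); last first.
    by rewrite -kosmap_d -uE kosmap_kos0 raddfB /= fd0 subr0.
  split; first exact: kos_homog_map.
  by move=> G; apply/Qf; rewrite ffunE; exists (u G).
case=> u' [hu' /(_ _)/Qf Qu'] fxE.
have [u hu uE] := kos_lift fgr hu' Qu'.
have [duE duc] := kos_homog0E (kos_homog_d hu).
have [y xy] : exists y, x - kosd u set0 = res_d P i y.
  apply/fK; move/ffunP/(_ set0): fxE; rewrite -uE -kosmap_d !ffunE eqxx => fx.
  by rewrite raddfB /= fx subrr.
have xuc : x - kosd u set0 \in gm_comp (g := F i) c by rewrite rpredB.
have [y' y'c xy'] := gm_lift dgr xuc xy.
exists (tensK y'); first exact: tensK_comp.
rewrite torK_d_tensK -xy' raddfB /= [X in _ - X](_ : _ = 0) ?subr0 //.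
by apply/(tensK_eq0 duc); exists u.
Qed.

Definition tor_iso (M' : grmod K w) i :=
  @subquo_iso K (torK_mod P i) (kos M') *:%R (@polyC_scale _ _ (kos M')).

(** Both sides are F_0 / (im(d) + m F_0) in degree c; classes are matched through a common lift in
    F_0. *)
Lemma tor_iso0 :
  tor_iso (@tor_cycle _ _ _ _ _ P 0 c) (@tor_boundary _ _ _ _ _ P 0 c)
    (kos_cycle (fun _ : M => True) 0 c) (kos_boundary (fun _ : M => True) 0 c).
Proof.
have agr := @res_aug_graded _ _ _ _ _ P.
exists (fun x u => exists2 y : F 0, y \in gm_comp (g := F 0) c &
  x = tensK y /\ u = kos0 (res_aug P y)); split.
- by exists 0; rewrite ?rpred0 // !raddf0.
- move=> a x u x' u' [y yc [-> ->]] [y' y'c [-> ->]].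
  exists (y + a%:MP *: y'); first by rewrite rpredD ?gm_compZC.
  split; first by rewrite raddfD /= tensKZ mcoeffC eqxx mulr1.
  rewrite [res_aug P (_ + _)]raddfD /= [res_aug P (_ *: _)]linearZ /=.
  by rewrite [kos0 (_ + _)]raddfD /= [kos0 (_ *: _)]linearZ.
- by move=> x /tensK_onto[y yc ->]; exists (kos0 (res_aug P y)), y.
- move=> u [hu _ _]; have [uE uc] := kos_homog0E hu.
  have [y uy] := res_aug_surj P (u set0).
  have [y' y'c uy'] := gm_lift agr uc uy; exists (tensK y'), y' => //.
  by rewrite -uy'.
move=> x u [y yc [-> ->]]; split; first exact: tensK_comp.
  have hy := kos_homog_kos0 (agr _ _ yc).
  by split=> //; apply: kosd_homog0 hy.
apply: tor_boundaryP => // [z|z]; last exact: res_exact0.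
by split=> // _; apply: res_aug_surj.
Qed.

(** Tor_{i+1} is the kernel of Z_i/m Z_i -> F_i/m F_i for the syzygy Z_i: a Tor cycle lifts to y in
    F_{i+1}, and d y lies in Z_i and in m F_i, so that it bounds in the Koszul complex of F_i. *)
Lemma tor_isoS i :
  tor_iso (@tor_cycle _ _ _ _ _ P i.+1 c) (@tor_boundary _ _ _ _ _ P i.+1 c)
    (kos_null_cycle (@res_ker i) 0 c) (kos_boundary (@res_ker i) 0 c).
Proof.
have dgr := @res_d_graded _ _ _ _ _ P i.
exists (fun x u => exists2 y : F i.+1, y \in gm_comp (g := F i.+1) c &
  [/\ tensK (res_d P i y) = 0, x = tensK y & u = kos0 (res_d P i y)]); split.
- by exists 0; rewrite ?rpred0 // !raddf0.
- move=> a x u x' u' [y yc [dy -> ->]] [y' y'c [dy' -> ->]].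
  exists (y + a%:MP *: y'); first by rewrite rpredD ?gm_compZC.
  rewrite [res_d P i (_ + _)]raddfD /= [res_d P i (_ *: _)]linearZ /=.
  split; first by rewrite raddfD /= tensKZ dy dy' scaler0 addr0.
    by rewrite raddfD /= tensKZ mcoeffC eqxx mulr1.
  by rewrite [kos0 (_ + _)]raddfD /= [kos0 (_ *: _)]linearZ.
- move=> x [/tensK_onto[y yc ->]]; rewrite torK_d_tensK => dy.
  by exists (kos0 (res_d P i y)), y.
- move=> u [hu uK [u' hu' uE]]; have [uE0 uc] := kos_homog0E hu.
  have /res_kerP[y uy] := uK set0.
  have [y' y'c uy'] := gm_lift dgr uc uy; exists (tensK y'), y' => //.
  split; rewrite -?uy' //.
  by apply/(tensK_eq0 uc); exists u'; rewrite -?uE0.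
move=> x u [y yc [dy -> ->]]; split.
- by split; [apply: tensK_comp|rewrite torK_d_tensK].
- split; first exact: kos_homog_kos0 (dgr _ _ yc).
  + move=> G; rewrite ffunE; case: eqP => _; first exact: res_dK.
    by apply/res_kerP; exists 0; rewrite raddf0.
  + by apply/(tensK_eq0 (dgr _ _ yc)).
by apply: tor_boundaryP => // z; [apply: res_kerP|apply: res_exact].
Qed.

(** Each shift lowers the syzygy index by one and raises the Koszul degree by one; the last one,
    along the augmentation, reaches M. *)
Lemma res_shift j i :
  kos_iso (kos_null_cycle (@res_ker j) i c) (kos_boundary (@res_ker j) i c)
    (kos_cycle (fun _ : M => True) (i + j).+1 c)
    (kos_boundary (fun _ : M => True) (i + j).+1 c).
Proof.
elim: j i => [|j IH] i.
  rewrite addn0; apply: subquo_iso_sym.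
  apply: (kos_shift (f := res_aug P) i c (@res_aug_graded _ _ _ _ _ P)) => x.
  by split=> // _; apply: res_aug_surj.
rewrite -addSnnS; apply: subquo_iso_trans (IH i.+1); apply: subquo_iso_sym.
(* In positive degree null cycles and cycles agree, which lets consecutive shifts compose. *)
apply: (eq_subquo_iso (Z1 := kos_cycle (@res_ker j) i.+1 c)).
  by move=> x; apply: iff_sym; apply: kos_null_cycleS.
exact: (kos_shift i c (@res_d_graded _ _ _ _ _ P j) (@res_kerP j)).
Qed.

Lemma tor_koszul i :
  tor_iso (@tor_cycle _ _ _ _ _ P i c) (@tor_boundary _ _ _ _ _ P i c)
    (kos_cycle (fun _ : M => True) i c) (kos_boundary (fun _ : M => True) i c).
Proof.
case: i => [|i]; first exact: tor_iso0.
by apply: subquo_iso_trans (tor_isoS i) _; apply: res_shift.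
Qed.

End Tor.

Lemma quotient_dim_kermx (K : fieldType) m1 m2 m3 (A : 'M[K]_(m2, m3))
    (C : 'M[K]_(m1, m2)) : C *m A = 0 ->
  quotient_dim (fun r : 'rV_m2 => r *m A = 0) (fun r : 'rV_m2 => (r <= C)%MS)
    (\rank (kermx A) - \rank C).
Proof.
move=> CA0; have CkA : (C <= kermx A)%MS by apply/sub_kermxP.
(* A basis of a complement of the row space of [C] in the kernel of [A] represents a basis of the
   quotient. *)
pose W := (kermx A :\: C)%MS.
have <- : \rank W = (\rank (kermx A) - \rank C)%N.
  by rewrite -(mxrank_cap_compl (kermx A) C) (capmx_idPr CkA) addKn.
have sumE (e : {ffun 'I_(\rank W) -> K}) :
    \sum_i e i *: row i (row_base W) = (\row_i e i) *m row_base W.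
  by rewrite mulmx_sum_row; apply: eq_bigr => i _; rewrite mxE.
exists (fun i => row i (row_base W)); split=> [i|z zA].
  apply/sub_kermxP; apply: submx_trans (row_sub _ _) _.
  by rewrite eq_row_base diffmxSl.
have /sub_addsmxP[[u v] /= zE] : (z <= W + C)%MS.
  have : (z <= kermx A)%MS by apply/sub_kermxP.
  rewrite -(addsmx_diff_cap_eq (kermx A) C) => /submx_trans; apply.
  by rewrite addsmxS // capmxSr.
have /submxP[r rE] : (u *m W <= row_base W)%MS.
  by rewrite eq_row_base submxMl.
exists [ffun i => r 0 i]; split.
  rewrite sumE (_ : \row_i _ = r); last by apply/rowP => i; rewrite mxE ffunE.
  by rewrite zE rE addrAC subrr add0r submxMl.
move=> e; rewrite sumE => ze; apply/ffunP => i; rewrite ffunE.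
(* Uniqueness: two admissible combinations differ by an element of [W] that lies in [C], hence by 0,
   and [row_base W] is free. *)
have eW : ((\row_i e i - r) *m row_base W <= W :&: C)%MS.
  rewrite sub_capmx; apply/andP; split.
    by rewrite -(eq_row_base W) submxMl.
  rewrite mulmxBl -rE -opprB eqmx_opp.
  have -> : u *m W - \row_i e i *m row_base W =
      (z - \row_i e i *m row_base W) - v *m C.
    by rewrite zE [u *m W + _ - _]addrAC addrK.
  by rewrite addmx_sub ?eqmx_opp ?submxMl.
move: eW; rewrite capmx_diff submx0.
move=> /eqP/(congr1 (mulmx^~ (pinvmx (row_base W)))).
rewrite mul0mx -mulmxA mulmxVp ?row_base_free // mulmx1.
by move/rowP/(_ i)/eqP; rewrite !mxE subr_eq0 => /eqP.
Qed.

(** * The Koszul complex of a Veronese module as a simplicial chain complex *)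

Section VeroneseKoszul.

Variables (K : fieldType) (n d k : nat) (a : enumeration n d).
Variables (c : 'rV[int]_n) (D : {set {set 'I_(num_exps n d)}}).

Local Notation N := (num_exps n d).
Local Notation R := {mpoly K[N]}.
Local Notation M := (veronese K a k).
Local Notation w := (en_deg a).
Local Notation kosM := {ffun {set 'I_N} -> M}.

(* D is the set of Koszul degrees in which M has a one-dimensional component. *)
Hypothesis DP : forall G, G \in D <->
  exists m l, mdegZ m = c - wset w G /\ mdeg m = (k + l * d)%N.

(** The absolute values make the definition total; for G in [D] the entries are nonnegative
    already. *)
Definition monom_of (G : {set 'I_N}) : 'X_{1..n} :=
  [multinom `|(c - wset w G)%R 0%R i|%N | i < n].

Lemma monom_ofE m G : mdegZ m = c - wset w G -> m = monom_of G.
Proof.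
by move=> mG; apply/mnmP => i; rewrite mnmE -mG mxE absz_nat.
Qed.

(** Koszul degree i corresponds to p = i - 1, the dimension of a face with i elements. *)
Definition kos_coord (p : int) (u : kosM) : 'rV[K]_#|faces D p| :=
  \row_j (val (u (enum_val j)))@_(monom_of (enum_val j)).

Lemma facesP p G : reflect (G \in D /\ #|G|%:Z - 1 = p) (G \in faces D p).
Proof.
by rewrite inE; apply: (iffP andP) => [[? /eqP]|[? /eqP]].
Qed.

Lemma kos_coordB p (u u' : kosM) :
  kos_coord p (u - u') = kos_coord p u - kos_coord p u'.
Proof. by apply/rowP => j; rewrite !mxE !ffunE raddfB. Qed.

HB.instance Definition _ p :=
  GRing.isZmodMorphism.Build kosM 'rV[K]_#|faces D p| (kos_coord p)
    (kos_coordB p).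

Lemma val_polyCZ b (f : M) : val (b%:MP *: f) = b%:MP * val f :> {mpoly K[n]}.
Proof. by rewrite /GRing.scale /= /phi comp_mpolyC. Qed.

Lemma kos_coordZ p b (u : kosM) :
  kos_coord p (b%:MP *: u) = b *: kos_coord p u.
Proof.
by apply/rowP => j; rewrite !mxE !ffunE val_polyCZ mcoeffCM.
Qed.

Lemma kos_homog_out i (u : kosM) G : kos_homog i c u -> G \notin D -> u G = 0.
Proof.
move=> /(_ G)[uG _] /negP GD; apply: val_inj; apply/mpolyP => m; rewrite mcoeff0.
apply/eqP; apply/negPn/negP => nz; case: GD; apply/DP.
have /vero_compP/(_ m nz) mG := uG.
by have [l ml] := vero_predP _ _ _ (valP (u G)) m nz; exists m, l.
Qed.

(** In degree c - wset G the module is spanned by one monomial if G is in [D], and is zero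
    otherwise. *)
Lemma kos_coord_inj i (u : kosM) :
  kos_homog i c u -> kos_coord (i%:Z - 1) u = 0 -> u = 0.
Proof.
move=> hu u0; apply/ffunP => G; rewrite ffunE; have [uG uG0] := hu G.
have [Gi|/uG0//] := eqVneq #|G| i.
apply: val_inj; apply/mpolyP => m; rewrite mcoeff0; apply/eqP.
case: eqVneq => // nz; have /vero_compP/(_ m nz) mG := uG.
have [l ml] := vero_predP _ _ _ (valP (u G)) m nz.
have GD : G \in faces D (i%:Z - 1).
  by apply/facesP; rewrite Gi; split=> //; apply/DP; exists m, l.
have /rowP/(_ (enum_rank_in GD G)) := u0.
rewrite !mxE enum_rankK_in // -(monom_ofE mG) => E.
by rewrite E eqxx in nz.
Qed.

Lemma kos_coord_onto i (r : 'rV_#|faces D (i%:Z - 1)|) :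
  exists2 u : kosM, kos_homog i c u & kos_coord (i%:Z - 1) u = r.
Proof.
have /fin_all_exists[g hg] G : exists x : M, [/\ x \in gm_comp (c - wset w G),
    #|G| != i -> x = 0 &
    forall j, enum_val j = G -> (val x)@_(monom_of G) = r 0 j].
  have [GF|GF] := boolP (G \in faces D (i%:Z - 1)); last first.
    exists 0; split=> //; first exact: rpred0.
    by move=> j jG; rewrite -jG enum_valP in GF.
  have [/DP[m [l [mG ml]]] Gi] := facesP _ _ GF.
  pose f : {mpoly K[n]} := r 0 (enum_rank_in GF G) *: 'X_[m].
  have fc m' : f@_m' != 0 -> m' = m.
    by rewrite mcoeffZ mcoeffX; case: (m =P m') => // _; rewrite mulr0 eqxx.
  have fV : f \in vero_pred d k.
    by apply/vero_predP => m' /fc->; exists l.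
  exists (Sub f fV : vero K k a); split.
  - by apply/vero_compP => m' /fc->.
  - by move/eqP: Gi; rewrite (inj_eq (addIr _)) => /eqP[->]; rewrite eqxx.
  move=> j jG; rewrite /= -(monom_ofE mG) mcoeffZ mcoeffX eqxx mulr1.
  by congr (r 0 _); apply: enum_val_inj; rewrite enum_rankK_in.
exists [ffun G => g G] => [G|]; first by rewrite ffunE; case: (hg G).
by apply/rowP => j; rewrite mxE ffunE; case: (hg (enum_val j)) => _ _; apply.
Qed.

Lemma val_phiX v (f : M) : val ('X_v *: f) = 'X_[a v] * val f :> {mpoly K[n]}.
Proof.
by rewrite /GRing.scale /= /phi comp_mpolyXU -tnth_nth tnth_mktuple.
Qed.

(** Since y_v acts as x^(a_v), it sends the monomial attached to v |: G to the one attached to G;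
    only the signs remain, and they are the incidence numbers. *)
Lemma kos_coord_d i (u : kosM) : kos_homog i.+1 c u ->
  kos_coord (i%:Z - 1) (kosd u) =
  kos_coord (i.+1%:Z - 1) u *m boundary K D (i.+1%:Z - 1) (i%:Z - 1).
Proof.
move=> hu; apply/rowP => j; rewrite !mxE ffunE.
set G := enum_val j.
have [GD Gi] : G \in D /\ #|G| = i.
  by have /facesP[? /addIr[]] := enum_valP j.
pose x F : K := (val (u F))@_(monom_of F).
have -> : (val (\sum_(v | v \notin G) ksign R v G *: ('X_v *: u (v |: G))))
    @_(monom_of G) =
    \sum_(v | (v \notin G) && (v |: G \in D)) ksign K v G * x (v |: G).
  rewrite raddf_sum [LHS]raddf_sum big_mkcondr; apply: eq_bigr => v vG.
  transitivity ((val (ksign R v G *: ('X_v *: u (v |: G))))@_(monom_of G)) => //.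
  have -> : ksign R v G = (ksign K v G)%:MP by rewrite /ksign rmorphXn rmorphN1.
  rewrite val_polyCZ mcoeffCM val_phiX; case: ifPn => vGD; last first.
    by rewrite (kos_homog_out hu vGD) mulr0 mcoeff0 mulr0.
  have [m [l [mvG _]]] := (DP _).1 vGD.
  suff -> : monom_of G = (m + a v)%MM.
    by rewrite ['X_[_] * _]mulrC addmC mcoeffMX /x -(monom_ofE mvG).
  apply/esym/monom_ofE; rewrite mdegZD mvG /wset big_setU1 //= -/(en_deg a v).
  by rewrite opprD addrA addrAC subrK.
transitivity (\sum_(F in faces D (i.+1%:Z - 1)) x F * incidence K F G).
  rewrite /incidence; under [RHS]eq_bigr do rewrite mulr_sumr.
  rewrite (exchange_big_dep xpredT) //= big_mkcond; apply: eq_bigr => v _.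
  case: ifPn => [/andP[vG vGD]|vGD].
    rewrite (big_pred1 (v |: G)) => [|F].
      (* The sign in [incidence] counts the elements of F below v, and v is not one of them, so it
         is the Koszul sign over G. *)
      by rewrite mulrC -/(ksign K v (v |: G)) ksignU1 // ltnn mul1r.
    apply/andP/eqP => [[_ /andP[vF /eqP->]]|->]; first by rewrite setD1K.
    split; last by rewrite setU11 setU1K ?eqxx.
    by apply/facesP; rewrite cardsU1 vG Gi.
  rewrite big_pred0 // => F; apply: contraNF vGD => /andP[/facesP[FD _]].
  by move=> /andP[vF /eqP->]; rewrite setD11 setD1K.
rewrite big_enum_val.
by apply: eq_bigr => l _; rewrite !mxE.
Qed.

Lemma kos_coord_cycle i (u : kosM) : kos_homog i c u ->
  kosd u = 0 <->
  kos_coord (i%:Z - 1) u *m boundary K D (i%:Z - 1) (i%:Z - 1 - 1) = 0.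
Proof.
case: i => [|i] hu.
  (* For i = 0 the target is spanned by faces of dimension -2, of which there are none. *)
  split=> _; last exact: kosd_homog0 hu.
  apply/rowP => j; have /facesP[_] := enum_valP j.
  by move/eqP; rewrite subr_eq.
have -> : i.+1%:Z - 1 - 1 = i%:Z - 1 by rewrite -[in LHS]addn1 PoszD addrK.
rewrite -kos_coord_d //; split=> [->|]; first by rewrite raddf0.
by apply: kos_coord_inj; apply: kos_homog_d.
Qed.

Lemma koszul_veronese_iso i :
  @subquo_iso K kosM 'rV[K]_#|faces D (i%:Z - 1)| (@polyC_scale _ _ kosM) *:%R
    (kos_cycle (fun _ : M => True) i c) (kos_boundary (fun _ : M => True) i c)
    (fun r => r *m boundary K D (i%:Z - 1) (i%:Z - 1 - 1) = 0)
    (fun r => (r <= boundary K D (i%:Z - 1 + 1) (i%:Z - 1))%MS).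
Proof.
have -> : i%:Z - 1 + 1 = i.+1%:Z - 1
  by rewrite subrK -[in RHS]addn1 PoszD addrK.
exists (fun u r => kos_cycle (fun _ : M => True) i c u /\
  r = kos_coord (i%:Z - 1) u); split.
- by rewrite raddf0; do 2!split=> //; [apply: kos_homog0|rewrite raddf0].
- move=> b u r u' r' [[hu _ du] ->] [[hu' _ du'] ->]; split; last first.
    by rewrite raddfD /= kos_coordZ.
  split=> //; first exact: kos_homog_axpy.
  by rewrite raddfD /= [kosd (_ *: _)]linearZ /= du du' scaler0 addr0.
- by move=> u hu; exists (kos_coord (i%:Z - 1) u).
- move=> r; have [u hu <-] := kos_coord_onto r.
  by move=> /(kos_coord_cycle hu) du; exists u.
move=> u r [[hu _ du] ->]; split=> //; first exact/kos_coord_cycle.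
split=> [[u' [hu' _] ->]|/submxP[r' uE]]; first by rewrite kos_coord_d ?submxMl.
have [u' hu' r'E] := kos_coord_onto r'.
exists u' => //; apply/eqP; rewrite -subr_eq0; apply/eqP.
apply: (@kos_coord_inj i); first by apply: kos_homogB => //; apply: kos_homog_d.
by rewrite raddfB /= kos_coord_d // r'E uE subrr.
Qed.

(** Each row of the first matrix is the coordinate vector of a Koszul boundary, so [kosdK] replaces
    a sign computation on faces. *)
Lemma boundaryK i : boundary K D (i%:Z - 1 + 1) (i%:Z - 1) *m
  boundary K D (i%:Z - 1) (i%:Z - 1 - 1) = 0.
Proof.
have -> : i%:Z - 1 + 1 = i.+1%:Z - 1
  by rewrite subrK -[in RHS]addn1 PoszD addrK.
apply/row_matrixP => j; rewrite row0 rowE mulmxA.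
have [u hu <-] := kos_coord_onto (delta_mx 0 j).
rewrite -kos_coord_d //; apply/kos_coord_cycle; first exact: kos_homog_d.
exact: kosdK.
Qed.

(** With [D] constrained only by [DP], this covers both the skeleton of the pile complex and the
    complex without faces. *)
Lemma betti_veronese i :
  betti_eq M i c (rhomology_dim K D (i%:Z - 1)).
Proof.
move=> P; apply: subquo_iso_dim (quotient_dim_kermx (boundaryK i)).
exact: subquo_iso_trans (tor_koszul P c i) (koszul_veronese_iso i).
Qed.

End VeroneseKoszul.

(** * Total degrees and the two cases of the theorem *)

Lemma absvB n (b c : 'rV[int]_n) : absv (b - c) = absv b - absv c.
Proof. by rewrite /absv -sumrB; apply: eq_bigr => i _; rewrite !mxE. Qed.

Lemma absv_mdegZ n (m : 'X_{1..n}) : absv (mdegZ m) = (mdeg m)%:Z.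
Proof.
rewrite mdegE (big_morph Posz PoszD (erefl _)).
by apply: eq_bigr => i _; rewrite mxE.
Qed.

Lemma absv_wset n d (a : enumeration n d) G :
  absv (wset (en_deg a) G) = #|G|%:Z * d%:Z.
Proof.
rewrite /absv /wset; under eq_bigr do rewrite summxE.
rewrite exchange_big /= (eq_bigr (fun=> d%:Z)) => [|v _].
  by rewrite sumr_const -mulr_natl natz.
by rewrite -/(absv _) absv_mdegZ en_mdeg.
Qed.

Theorem theorem3p1 (K : fieldType) (n d k : nat) (n_gt0 : (0 < n)%N)
    (d_gt0 : (0 < d)%N) (a : enumeration n d) (c : 'rV[int]_n) :
  (forall j : int, absv c = k%:Z + j * d%:Z ->
     forall i : nat,
       betti_eq (veronese K a k) i c
         (rhomology_dim K (skeleton (j - 1) (pile a c)) (i%:Z - 1)))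
  /\
  ((forall j : int, absv c <> k%:Z + j * d%:Z) ->
     forall i : nat, betti_eq (veronese K a k) i c 0).
Proof.
split=> [j cE i|cE i].
  apply: betti_veronese => G; rewrite !inE -/(wset (en_deg a) G) /face_dim lerD2r.
  split=> [/andP[/forallP Gc Gj]|[m [l [mG ml]]]].
    have mG : mdegZ (monom_of a c G) = c - wset (en_deg a) G.
      apply/rowP => v; rewrite mxE mnmE gez0_abs // !mxE subr_ge0.
      exact: Gc.
    (* The total degree is |c| - #|G| d = k + (j - #|G|) d, and the skeleton condition makes j -
       #|G| nonnegative. *)
    exists (monom_of a c G), `|(j - #|G|%:Z)|%N; split=> //.
    apply/eqP; rewrite -eqz_nat PoszD PoszM gez0_abs ?subr_ge0 //.
    by rewrite -absv_mdegZ mG absvB absv_wset cE mulrBl addrA.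
  apply/andP; split.
    apply/forallP => v; have /rowP/(_ v) := mG; rewrite !mxE => E.
    by rewrite -subr_ge0 -E.
  have := congr1 (@absv n) mG; rewrite absv_mdegZ ml absvB absv_wset cE.
  (* Cancelling d > 0 gives l = j - #|G|, and l >= 0 is the skeleton condition. *)
  rewrite PoszD PoszM -addrA -mulrBl => /addrI/mulIf E.
  by rewrite -subr_ge0 -E // eqz_nat -lt0n.
(* The value 0 is written as the homology of the complex without faces, to use [D] = [set0]. *)
have -> : 0%N =
    rhomology_dim K (set0 : {set {set 'I_(num_exps n d)}}) (i%:Z - 1).
  apply/esym/eqP; rewrite subn_eq0.
  apply: leq_trans (rank_leq_row _) (leq_trans _ (leq0n _)).
  by rewrite leqn0 cards_eq0; apply/eqP/setP => G; rewrite !inE.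
apply: betti_veronese => G; rewrite inE; split=> // -[m [l [mG ml]]].
(* A monomial of M in degree c - wset G would give |c| = k + (l + #|G|) d. *)
case: (cE (l%:Z + #|G|%:Z)).
by rewrite mulrDl addrA -(absv_wset a) -PoszM -PoszD -ml -absv_mdegZ mG absvB subrK.
Qed.
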